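(* Let $2\le k\le n-1$. A weighted $k$-form $\sigma\in\mathcal E^k[k+1]$ is a conformal Killing $k$-form if and only if $$\tilde\nabla_{(a}\overline\sigma_{b)_0}=0,$$ i.e. the symmetric trace-free part in $a,b$ of $\tilde\nabla_a\overline\sigma_{b\dot{\mathbf B}^k}$ vanishes. Here $\tilde\nabla$ is the Levi-Civita connection coupled with the tractor connection $\tilde\nabla_c=\nabla_c+\frac{2}{n-k}\kappa_c\sharp\sharp$ ($\nabla$ on the right-hand side being the normal tractor connection), and $\overline\sigma_{a^1\dot{\mathbf B}^k}\in\mathcal E_{a^1\dot{\mathbf B}^k}[2]$ is the conformally invariant tractor extension of $\sigma$ (with $l=k-1$ tractor indices).
   Context: Setting. $M$ is a smooth $n$-manifold, $n\ge3$, with a conformal structure $[g]$ (any signature); all objects are smooth. $\mathcal E[w]$: conformal densities of weight $w$ (a choice $g\in[g]$ trivialises $\mathcal E[w]$; under $\hat g=e^{2\Upsilon}g$ the representing function $f$ becomes $e^{w\Upsilon}f$); $[w]$ after a bundle means tensoring with it. One symbol is used for a bundle and its sections. $\mathbf g_{ab}$ is the conformal metric (tautological section of $S^2T^*M[2]$), used to raise, lower and contract abstract indices. $\nabla$ is the Levi-Civita connection of a chosen $g\in[g]$, acting also on densities via the trivialisation; $\Upsilon_a=\nabla_a\Upsilon$. Curvature. $[\nabla_a,\nabla_b]v^c=R_{ab}{}^c{}_dv^d$, $R_{abcd}=C_{abcd}+2\mathbf g_{c[a}P_{b]d}+2\mathbf g_{d[b}P_{a]c}$ with $C$ the trace-free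 Weyl tensor and $P$ the symmetric Schouten tensor; $A_{abc}=2\nabla_{[b}P_{c]a}$. Form indices. $\mathcal E^k=\mathcal E_{\mathbf a^k}$ is the bundle of $k$-forms. Indices with sequential superscripts at the same level are implicitly skew-symmetrised (projection, weight one): $\mathbf a^k=a^1\cdots a^k$, $\dot{\mathbf b}^k=b^2\cdots b^k$, $\ddot{\mathbf b}^k=b^3\cdots b^k$, and similarly for tractor indices. Conformal Killing forms. $\sigma\in\mathcal E^k[k+1]$ is a conformal Killing $k$-form if $\nabla_{\{c}\sigma_{\mathbf a^k\}_0}=0$, i.e. the projection of $\nabla_c\sigma_{\mathbf a^k}$ to the trace-free part of $\{f_{c\mathbf a^k}: f_{[c\mathbf a^k]}=0\}$ vanishes. Tractors. For each $g\in[g]$ the standard tractor bundle is $[\mathcal E^A]_g=\mathcal E[1]\oplus\mathcal E_a[1]\oplus\mathcal E[-1]$, with $(\alpha,\mu_a,\tau)_g$ identified with $(\alpha,\ \mu_a+\Upsilon_a\alpha,\ \tau-\Upsilon^b\mu_b-\tfrac12\Upsilon^b\Upsilon_b\alpha)_{\hat g}$. The tractor metric (quadratic form $2\alpha\tau+\mu^a\mu_a$) raises and lowers tractor indices. Normal tractor connection: $\nabla_a(\alpha,\mu_b,\tau)=(\nabla_a\alpha-\mu_a,\ \nabla_a\mu_b+\mathbf g_{ab}\tau+P_{ab}\alpha,\ \nabla_a\tau-P_{ab}\mu^b)$. Writing $V_A=Y_A\alpha+Z_A{}^a\mu_a+X_A\tau$ defines $Y_A,Z_A{}^a,X_A$.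 The tractor curvature is $[\nabla_a,\nabla_b]V^C=\Omega_{ab}{}^C{}_EV^E$, explicitly $\Omega_{abCE}=Z_C{}^cZ_E{}^eC_{abce}-2X_{[C}Z_{E]}{}^eA_{eab}$. Tractor extension (tractor indices $B^2\cdots B^k$ skewed): $$\overline\sigma_{a^1\dot{\mathbf B}^k}=(n-k+1)Z_{B^2}{}^{b^2}\cdots Z_{B^k}{}^{b^k}\sigma_{a^1b^2\cdots b^k}-(k-1)X_{B^2}Z_{B^3}{}^{b^3}\cdots Z_{B^k}{}^{b^k}\nabla^{b^2}\sigma_{a^1b^2\cdots b^k}.$$ Field $\kappa$: $\kappa_{cE^0E^1F^0F^1}=X_{[E^0}Z_{E^1]}{}^{e}\Omega_{ceF^0F^1}$, viewed (raising the first index of each pair with the tractor metric) as a 1-form with values in $\mathrm{End}(\mathcal E^A)\otimes\mathrm{End}(\mathcal E^A)$. For a tractor endomorphism $S$, $S\sharp$ is its natural derivation action on tractors (e.g. $S\sharp T_{AB}=-S^C{}_AT_{CB}-S^C{}_BT_{AC}$); $\kappa_c\sharp\sharp$ is the double action, applying the $\sharp$-action of the second factor and then that of the first. *)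

(* Defs.v *)
From HB Require Import structures.
From mathcomp Require Import all_boot all_order all_algebra all_fingroup.
From mathcomp Require Import all_classical all_reals all_analysis.

Set Implicit Arguments.
Unset Strict Implicit.
Unset Printing Implicit Defensive.

Import Order.TTheory GRing.Theory Num.Theory numFieldNormedType.Exports.

Local Open Scope classical_set_scope.
Local Open Scope ring_scope.

Definition permute (T : Type) (s : seq T) (pi : 'S_(size s)) : seq T :=
  [seq tnth (in_tuple s) (pi i) | i <- enum 'I_(size s)].

(* F_[s], skew-symmetrisation as a projection (weight one) *)
Definition skewsym (R : realType) (T : Type) (F : seq T -> R) (s : seq T) : R :=
  (size s)`!%:R^-1 *
  \sum_(pi : 'S_(size s)) (-1) ^+ odd_perm pi * F (permute pi).

(* The coframe slots of the standard tractor bundle in the splitting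
   E[1] + E_a[1] + E[-1] determined by a scale and a coordinate chart: a tractor
   V_A = Y_A alpha + Z_A^a mu_a + X_A tau has the components alpha, mu_a, tau
   at slotY, slotZ a, slotX.  A tractor with several indices has one component
   for each sequence of slots. *)
Definition slot (n : nat) : finType := (unit + 'I_n + unit)%type.
Definition slotY n : slot n := inl (inl tt).
Definition slotZ n (a : 'I_n) : slot n := inl (inr a).
Definition slotX n : slot n := inr tt.

(* Local tensor calculus in one coordinate chart and one scale g.  The scale
   trivialises all density bundles, so weights do not show in components.
   A component function takes the sequence of its coordinate indices, the
   sequence of its tractor slots, and the point. *)
Section LocalCalculus.
Context {R : realType} {n : nat}.

Notation point := 'rV[R]_n.
Notation field := (seq 'I_n -> seq (slot n) -> point -> R).

Definition partial (c : 'I_n) (f : point -> R) (x : point) : R :=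
  'D_(delta_mx ord0 c) f x.

Definition smooth_on (U : set point) (f : point -> R) : Prop :=
  forall (s : seq 'I_n) (x : point), U x -> differentiable (foldr partial f s) x.

Section Scale.
Variable g : 'I_n -> 'I_n -> point -> R.

Definition ginv (a b : 'I_n) (x : point) : R :=
  invmx (\matrix_(i, j) g i j x) a b.

(* Gamma^d_{cb} *)
Definition christoffel (d c b : 'I_n) (x : point) : R :=
  2^-1 * \sum_e ginv d e x *
    (partial c (g b e) x + partial b (g c e) x - partial e (g c b) x).

(* R_{ab}^c_d, normalised by [nabla_a, nabla_b] v^c = R_{ab}^c_d v^d *)
Definition riemann_up (a b c d : 'I_n) (x : point) : R :=
  partial a (christoffel c b d) x - partial b (christoffel c a d) x
  + \sum_e (christoffel c a e x * christoffel e b d x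
            - christoffel c b e x * christoffel e a d x).

Definition riemann (a b c d : 'I_n) (x : point) : R :=
  \sum_e g c e x * riemann_up a b e d x.

Definition ricci (b d : 'I_n) (x : point) : R := \sum_a riemann_up a b a d x.

Definition scalar_curvature (x : point) : R :=
  \sum_a \sum_b ginv a b x * ricci a b x.

Definition schouten (a b : 'I_n) (x : point) : R :=
  (n%:R - 2)^-1 *
  (ricci a b x - scalar_curvature x / (2 * (n%:R - 1)) * g a b x).

Definition weyl (a b c d : 'I_n) (x : point) : R :=
  riemann a b c d x
  - (g c a x * schouten b d x - g c b x * schouten a d x)
  - (g d b x * schouten a c x - g d a x * schouten b c x).

(* The algebraic part of the normal tractor connection in the direction c: the
   s component of nabla_c V is the c-derivative of the s component of V plus
   tractor_conn c s V. *)
Definition tractor_conn (c : 'I_n) (s : slot n) (V : slot n -> R) (x : point)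
    : R :=
  match s with
  | inl (inl _) => - V (slotZ c)
  | inl (inr b) =>
      - (\sum_d christoffel d c b x * V (slotZ d))
      + g c b x * V (slotX n) + schouten c b x * V (slotY n)
  | inr _ => - \sum_a \sum_b schouten c a x * ginv a b x * V (slotZ b)
  end.

(* Levi-Civita connection coupled with the normal tractor connection *)
Definition nabla (c : 'I_n) (T : field) (I : seq 'I_n) (S : seq (slot n))
    (x : point) : R :=
  partial c (T I S) x
  - \sum_(j < size I) \sum_d
      christoffel d c (nth c I j) x * T (set_nth c I j d) S x
  + \sum_(j < size S)
      tractor_conn c (nth (slotY n) S j)
        (fun t => T I (set_nth (slotY n) S j t) x) x.

(* A_{abc} = 2 nabla_[b P_c]a *)
Definition cotton (a b c : 'I_n) (x : point) : R :=
  let P : field :=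
    fun I _ => if I is [:: p; q] then schouten p q else fun=> 0 in
  nabla b P [:: c; a] [::] x - nabla c P [:: b; a] [::] x.

(* Components of X_A and Z_A^a.  Only lower tractor indices have components
   here; they are raised and contracted with tractor_metric. *)
Definition tX (s : slot n) : R := (s == slotX n)%:R.
Definition tZ (s : slot n) (a : 'I_n) : R := (s == slotZ a)%:R.

Definition tractor_metric (s t : slot n) (x : point) : R :=
  match s, t with
  | inl (inl _), inr _ => 1
  | inr _, inl (inl _) => 1
  | inl (inr a), inl (inr b) => ginv a b x
  | _, _ => 0
  end.

(* Omega_{abCE} *)
Definition tractor_curv (a b : 'I_n) (C E : slot n) (x : point) : R :=
  \sum_c \sum_e tZ C c * tZ E e * weyl a b c e x
  - \sum_e (tX C * tZ E e - tX E * tZ C e) * cotton e a b x.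

(* kappa_{c E0 E1 F0 F1} *)
Definition kappa (c : 'I_n) (E0 E1 F0 F1 : slot n) (x : point) : R :=
  \sum_e 2^-1 * (tX E0 * tZ E1 e - tX E1 * tZ E0 e) *
         tractor_curv c e F0 F1 x.

(* (A # T)_{...B...} = - A^C_B T_{...C...} - ..., where A^C_B = h^{CD} A_{DB} *)
Definition sharp (A : slot n -> slot n -> R) (T : seq (slot n) -> R)
    (S : seq (slot n)) (x : point) : R :=
  - \sum_(j < size S) \sum_C \sum_D
      tractor_metric C D x * A D (nth (slotY n) S j) *
      T (set_nth (slotY n) S j C).

(* The linear extension to all K_{E0 E1 F0 F1} of
   A_{E0 E1} B_{F0 F1} |-> (T |-> A # (B # T)) *)
Definition sharp_sharp (K : slot n -> slot n -> slot n -> slot n -> R)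
    (T : seq (slot n) -> R) (S : seq (slot n)) (x : point) : R :=
  - \sum_(i < size S) \sum_C \sum_D
      tractor_metric C D x *
      sharp (K D (nth (slotY n) S i)) T (set_nth (slotY n) S i C) x.

(* nabla_c + 2/(n-k) kappa_c # # *)
Definition nabla_tilde (k : nat) (c : 'I_n) (T : field) (I : seq 'I_n)
    (S : seq (slot n)) (x : point) : R :=
  nabla c T I S x
  + 2 / (n%:R - k%:R) *
    sharp_sharp (fun E0 E1 F0 F1 => kappa c E0 E1 F0 F1 x) (T I ^~ x) S x.

(* The projection f_{c I} |-> f_{ {c I}_0 } of T^* (x) Lambda^k onto the
   trace-free part of the kernel of skew-symmetrisation: subtract f_[cI] and
   k/(n-k+1) g_{c[a^1} f^p_{|p| a^2...a^k]}.  The argument of f is c :: I. *)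
Definition killing_proj (k : nat) (f : seq 'I_n -> R) (c : 'I_n)
    (I : seq 'I_n) (x : point) : R :=
  f (c :: I) - skewsym f (c :: I)
  - k%:R / (n%:R - k%:R + 1) *
    skewsym (fun J => if J is b :: J' then
                     g c b x * \sum_p \sum_q ginv p q x * f [:: p, q & J']
                   else 0) I.

Definition killing_operator (k : nat) (sigma : seq 'I_n -> point -> R)
    (c : 'I_n) (I : seq 'I_n) (x : point) : R :=
  killing_proj k
    (fun J => if J is d :: J' then nabla d (fun L _ => sigma L) J' [::] x else 0)
    c I x.

Definition tZs (S : seq (slot n)) (b : seq 'I_n) : R :=
  \prod_(p <- zip S b) tZ p.1 p.2.

(* nabla^q sigma_{a q b^3...b^k} *)
Definition divergence (sigma : seq 'I_n -> point -> R) (a : 'I_n)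
    (b : seq 'I_n) (x : point) : R :=
  \sum_p \sum_q ginv p q x * nabla p (fun L _ => sigma L) [:: a, q & b] [::] x.

Definition tractor_extension (k : nat) (sigma : seq 'I_n -> point -> R)
    : field := fun I S x =>
  if I is [:: a] then
    skewsym (fun S' =>
      (n%:R - k%:R + 1) *
        (\sum_(b : (k - 1).-tuple 'I_n) tZs S' b * sigma (a :: b) x)
      - (k%:R - 1) *
        (if S' is B :: S'' then
           tX B * \sum_(b : (k - 2).-tuple 'I_n)
                    tZs S'' b * divergence sigma a b x
         else 0)) S
  else 0.

(* T_{(ab)_0} *)
Definition sym_tracefree (T : 'I_n -> 'I_n -> R) (a b : 'I_n) (x : point) : R :=
  2^-1 * (T a b + T b a)
  - n%:R^-1 * g a b x * \sum_p \sum_q ginv p q x * T p q.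

End Scale.
End LocalCalculus.

(* cinv is meaningful only on the image of cmap *)
Record chart (R : realType) (n : nat) (M : topologicalType) := Chart {
  cdom : set M;
  cmap : M -> 'rV[R]_n;
  cinv : 'rV[R]_n -> M;
  _ : open cdom;
  _ : open (cmap @` cdom);
  _ : forall p, cdom p -> cinv (cmap p) = p;
  _ : {within cdom, continuous cmap};
  _ : {within cmap @` cdom, continuous cinv} }.

Definition cimg (R : realType) (n : nat) (M : topologicalType)
  (phi : chart R n M) : set 'rV[R]_n := cmap phi @` cdom phi.

Definition transition (R : realType) (n : nat) (M : topologicalType)
    (phi psi : chart R n M) (a : 'I_n) (x : 'rV[R]_n) : R :=
  cmap psi (cinv phi x) ord0 a.

Record manifold (R : realType) (n : nat) := Manifold {
  mspace :> topologicalType;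
  mindex : Type;
  mchart : mindex -> chart R n mspace;
  _ : hausdorff_space mspace;
  _ : @second_countable mspace;
  _ : forall p : mspace, exists i, cdom (mchart i) p;
  _ : forall i j (a : 'I_n),
      smooth_on (cmap (mchart i) @` (cdom (mchart i) `&` cdom (mchart j)))
                (transition (mchart i) (mchart j) a) }.

Section GlobalObjects.
Context {R : realType} {n : nat} (M : manifold R n).

(* Smooth sections of the r-th tensor power of T^*M, by their components in
   each chart of the atlas, as functions of the coordinates.  Only sequences of
   r indices and points of the image of the chart are meaningful. *)
Record covariant_tensor (r : nat) := CovariantTensor {
  tcomp :> mindex M -> seq 'I_n -> 'rV[R]_n -> R;
  _ : forall i (I : r.-tuple 'I_n), smooth_on (cimg (mchart i)) (tcomp i I);
  _ : forall i j (I : r.-tuple 'I_n) p,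
      cdom (mchart i) p -> cdom (mchart j) p ->
      tcomp i I (cmap (mchart i) p) =
      \sum_(J : r.-tuple 'I_n)
        (\prod_(l < r) partial (tnth I l)
                         (transition (mchart i) (mchart j) (tnth J l))
                         (cmap (mchart i) p)) *
        tcomp j J (cmap (mchart j) p) }.

Record metric := Metric {
  metric_tensor :> covariant_tensor 2;
  _ : forall i a b x, cimg (mchart i) x ->
      metric_tensor i [:: a; b] x = metric_tensor i [:: b; a] x;
  _ : forall i x, cimg (mchart i) x ->
      \det (\matrix_(a < n, b < n) metric_tensor i [:: a; b] x) != 0 }.

Record form (k : nat) := Form {
  form_tensor :> covariant_tensor k;
  _ : forall i (I : seq 'I_n) (pi : 'S_(size I)) x,
      size I = k -> cimg (mchart i) x ->
      form_tensor i (permute pi) x = (-1) ^+ odd_perm pi * form_tensor i I x }.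

Definition smooth_function (f : M -> R) : Prop :=
  forall i, smooth_on (cimg (mchart i)) (f \o cinv (mchart i)).

(* T' = e^{w Upsilon} T *)
Definition rescaled (w : R) (Upsilon : M -> R) (r : nat)
    (T T' : covariant_tensor r) : Prop :=
  forall i (I : r.-tuple 'I_n) x, cimg (mchart i) x ->
    T' i I x = expR (w * Upsilon (cinv (mchart i) x)) * T i I x.

Record conformal_structure := ConformalStructure {
  scales : set metric;
  _ : scales !=set0;
  _ : forall g g', scales g ->
      (scales g' <-> exists2 Upsilon, smooth_function Upsilon &
                                      rescaled 2 Upsilon g g') }.

(* Sections of E^k[w] over (M, c): one k-form for each scale *)
Record weighted_form (c : conformal_structure) (k : nat) (w : R) :=
  WeightedForm {
    in_scale :> metric -> form k;
    _ : forall (g g' : metric) Upsilon, scales c g -> smooth_function Upsilon ->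
        rescaled 2 Upsilon g g' ->
        rescaled w Upsilon (in_scale g) (in_scale g') }.

Definition local_metric (g : metric) (i : mindex M) (a b : 'I_n)
    : 'rV[R]_n -> R := g i [:: a; b].

(* nabla_{ {c} sigma_{a^k}_0 } = 0 for the Levi-Civita connection of g *)
Definition conformal_killing (k : nat) (g : metric) (sigma : form k) : Prop :=
  forall i x, cimg (mchart i) x -> forall (c : 'I_n) (I : k.-tuple 'I_n),
    killing_operator (local_metric g i) k (sigma i) c I x = 0.

(* The symmetric trace-free part of nabla_tilde_a sigmabar_{b B^2...B^k} is 0,
   in the splitting given by g *)
Definition tractor_killing (k : nat) (g : metric) (sigma : form k) : Prop :=
  forall i x, cimg (mchart i) x ->
  forall (a b : 'I_n) (S : (k - 1).-tuple (slot n)),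
    let gi := local_metric g i in
    sym_tracefree gi
      (fun p q => nabla_tilde gi k p (tractor_extension gi k (sigma i))
                    [:: q] S x)
      a b x = 0.

End GlobalObjects.

(* Main.v *)
Require Import Defs.
From mathcomp Require Import all_boot all_order all_algebra all_fingroup.
From mathcomp Require Import all_classical all_reals all_analysis.
From mathcomp Require Import ring lra.

Set Implicit Arguments.
Unset Strict Implicit.
Unset Printing Implicit Defensive.

Import Order.TTheory GRing.Theory Num.Theory numFieldNormedType.Exports.

Local Open Scope classical_set_scope.
Local Open Scope ring_scope.

(** The statement is local and concerns one scale, so it is a computation with
components in a chart.  Put N = n - k + 1 and let delta be the (k-1)-form
g^{pq} nabla_p sigma_{q ...}.

Split the trace part off the first derivative,
  nabla_c sigma_{ab} = tau_{cab} + N^-1 (g_{ca} delta_b - ...),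
where the bracket is the full alternating sum over the form indices; tau then has
vanishing trace in its first two indices.  As nabla sigma is skew in the form
indices, so is tau, and sigma is conformal Killing exactly when tau is totally
skew.

The extension sigmabar has components N sigma_{ab} in the slots Z...Z, the
components delta_{ab'} in the slots X Z...Z (up to order), and no others.  The
double action of kappa lowers the tractor filtration: its only effect is to turn
Z...Z components into an X Z...Z component.  Hence the components of the
derivative of sigmabar_a in the direction c are the following.

- One slot Y: the component of -sigmabar_a with Z_c in place of Y.  It is
  skew in a and c for every sigma.
- Slots Z...Z: N tau_{cab} + g_{ca} delta_b.  The symmetric trace-free part in a
  and c is N tau_{(ca)b}; it vanishes exactly when tau, already skew in its last
  indices, is totally skew.  So this component alone gives the backward
  implication (nabla_tilde_killing).
- Slots X Z...Z: nabla_c delta_{ab'} - N P_c^p sigma_{apb'} plus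
  N/(n-k) times the contracted action of the Weyl curvature C_c^p on the
  indices p b' of sigma_{apb'} (not on a).

For the forward implication the last component has to be skew in a and c
(x_component_skew).  Contract the Ricci identity for sigma and insert the
splitting of nabla sigma: the divergence of tau is skew, the divergence of delta
vanishes, and there remains
  (1 - 1/N) nabla_c delta_{ab'} = (R_c^p # sigma)_{pab'} modulo skew terms
(cov_codiff_killing).  With R = C + (terms in g and P), the kappa term removes C,
and the terms in P add up to -(n-k) P_c^p sigma_{pab'} by counting form indices
(curvature_skew); this cancels the remaining Schouten term because
1 - 1/N = (n-k)/N. *)

(** * Alternating functions of lists *)

Section Alternation.
Context {R : comPzRingType} {V : Type}.
Implicit Types (F : seq V -> R) (G : V -> seq V -> R) (s u v : seq V).

(** Skewness is required for adjacent transpositions only.  These generate all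
permutations, and they are the ones that list induction can see. *)
Definition alternates m F := forall u a b v,
  (size u + size v).+2 = m -> F (u ++ a :: b :: v) = - F (u ++ b :: a :: v).

(** The alternating sum over all ways to bring one entry of the list to the
front: sum_j (-1)^j G s_j (s without s_j).  For G a t = h a * F t this is the
wedge product of the one-form h with F, before any normalisation. *)
Fixpoint front_sum G s : R :=
  if s is a :: t then G a t - front_sum (fun b u => G b (a :: u)) t else 0.

(** The sum over all permutations with signs, expanded along the first
argument.  This recursive form replaces permutation groups in the later proofs. *)
Fixpoint alt_sum m F s : R :=
  if m is m'.+1 then front_sum (fun a t => alt_sum m' (fun u => F (a :: u)) t) s
  else F s.

Lemma alternates_swap m F a b v :
  alternates m F -> (size v).+2 = m -> F (a :: b :: v) = - F (b :: a :: v).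
Proof. by move=> altF sz; apply: (altF [::]). Qed.

Lemma alternates_cons m F a :
  alternates m.+1 F -> alternates m (fun s => F (a :: s)).
Proof. by move=> altF u b c v sz; apply: (altF (a :: u)); rewrite /= addSn sz. Qed.

Lemma alternatesS m F :
  (forall a, alternates m (fun s => F (a :: s))) ->
  (forall a b v, (size v).+1 = m -> F (a :: b :: v) = - F (b :: a :: v)) ->
  alternates m.+1 F.
Proof. by move=> altF swF [|c u] a b v [sz]; [apply: swF | apply: altF]. Qed.

Lemma alternates_eq m F F' :
  (forall s, size s = m -> F s = F' s) -> alternates m F -> alternates m F'.
Proof.
move=> FF' altF u a b v sz.
have szE x y : size (u ++ x :: y :: v) = m by rewrite size_cat /= -sz !addnS.
by rewrite -(FF' _ (szE a b)) -(FF' _ (szE b a)); apply: altF.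
Qed.

Lemma front_sum_eq m G G' s : size s = m.+1 ->
  (forall a t, size t = m -> G a t = G' a t) -> front_sum G s = front_sum G' s.
Proof.
elim: m s G G' => [|m IH] [|a s] // G G' [sz] GG' /=; rewrite GG' //.
  by case: s sz.
by congr (_ - _); apply: IH => // b t szt; apply: GG'; rewrite /= szt.
Qed.

Lemma front_sumD G G' s :
  front_sum (fun a t => G a t + G' a t) s = front_sum G s + front_sum G' s.
Proof. by elim: s G G' => [|a s IH] G G' /=; rewrite ?addr0 // IH; ring. Qed.

Lemma front_sumZ c G s :
  front_sum (fun a t => c * G a t) s = c * front_sum G s.
Proof. by elim: s G => [|a s IH] G /=; rewrite ?mulr0 // IH; ring. Qed.

Lemma front_sum_sum (J : finType) (G : J -> V -> seq V -> R) s :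
  front_sum (fun a t => \sum_j G j a t) s = \sum_j front_sum (G j) s.
Proof.
elim: s G => [|a s IH] G /=; first by rewrite big1.
by rewrite IH -sumrB.
Qed.

(** Each of the m terms is brought back to F s by moving one entry to its
place, and the sign of that move cancels the sign of the term. *)
Lemma front_sum_alternates m F s : alternates m F -> size s = m ->
  front_sum (fun a t => F (a :: t)) s = m%:R * F s.
Proof.
elim: m s F => [|m IH] [|a s] //= F altF sz; first by rewrite mul0r.
case: sz => sz; case: m IH altF sz => [|m] IH altF sz.
  by case: s sz => //=; rewrite subr0 mul1r.
rewrite (@front_sum_eq m _ (fun b t => - 1 * F (a :: b :: t))) //; last first.
  by move=> b t szt; rewrite mulN1r; apply: alternates_swap altF _; rewrite szt.
rewrite front_sumZ (IH _ (fun t => F (a :: t))) //; first by rewrite -[in RHS]natr1; ring.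
exact: alternates_cons.
Qed.

Lemma alternates_front_sum m G : (forall a, alternates m (G a)) ->
  alternates m.+1 (front_sum G).
Proof.
move=> altG u; elim: u m G altG => [|c u IH] m G altG a b v [sz] /=.
  case: m altG sz => [|m] // altG [sz].
  suff -> : front_sum (fun x t => G x (a :: b :: t)) v =
            - front_sum (fun x t => G x (b :: a :: t)) v by ring.
  case: v sz => [|x v] sz; first by rewrite /= oppr0.
  case: m sz altG => [|m] // [sz] altG.
  rewrite (@front_sum_eq (size v) _ (fun x t => -1 * G x (b :: a :: t))) //.
    by rewrite front_sumZ mulN1r.
  move=> y t szt; rewrite mulN1r; apply: alternates_swap (altG y) _.
  by rewrite szt sz.
rewrite /= addSn in sz; rewrite (altG c u) //.
case: m altG sz => // m altG [sz].
rewrite (IH m) ?opprD ?sz // => x; exact: alternates_cons (altG x).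
Qed.

Lemma alternates_alt_sum m F : alternates m (alt_sum m F).
Proof.
elim: m F => [|m IH] F /=; first by move=> u a b v.
by apply: alternates_front_sum => a; apply: IH.
Qed.

Lemma alt_sum_eq m F F' s : size s = m ->
  (forall t, size t = m -> F t = F' t) -> alt_sum m F s = alt_sum m F' s.
Proof.
elim: m F F' s => [|m IH] F F' s sz FF' /=; first exact: FF'.
apply: (@front_sum_eq m) => // a t szt; apply: IH => // u szu.
by apply: FF'; rewrite /= szu.
Qed.

Lemma alt_sumD m F F' s :
  alt_sum m (fun t => F t + F' t) s = alt_sum m F s + alt_sum m F' s.
Proof.
elim: m F F' s => [|m IH] F F' s //=; rewrite -front_sumD.
by congr (front_sum _ s); apply/funext => a; apply/funext => t; rewrite IH.
Qed.

Lemma alt_sumZ m c F s : alt_sum m (fun t => c * F t) s = c * alt_sum m F s.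
Proof.
elim: m F s => [|m IH] F s //=; rewrite -front_sumZ.
by congr (front_sum _ s); apply/funext => a; apply/funext => t; rewrite IH.
Qed.

Lemma alt_sum_alternates m F s : alternates m F -> size s = m ->
  alt_sum m F s = m`!%:R * F s.
Proof.
elim: m F s => [|m IH] F s altF sz /=; first by rewrite mul1r.
rewrite (@front_sum_eq m _ (fun a t => m`!%:R * F (a :: t))) //.
  by rewrite front_sumZ (front_sum_alternates altF) // factS natrM; ring.
by move=> a t szt; rewrite IH //; apply: alternates_cons.
Qed.

(** The (m+1)-fold alternation of a function that is already skew in the last m
arguments reduces to moving each entry to the front. *)
Lemma alt_sum_alternates_tail m F s :
  (forall a, alternates m (fun t => F (a :: t))) -> size s = m.+1 ->
  alt_sum m.+1 F s = m`!%:R * front_sum (fun a t => F (a :: t)) s.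
Proof.
move=> altF sz; rewrite -front_sumZ; apply: (@front_sum_eq m) => // a t szt.
exact: alt_sum_alternates.
Qed.

(** Taking out two entries in the opposite order costs one sign. *)
Lemma front_sum_swap (H : V -> V -> seq V -> R) s :
  front_sum (fun a => front_sum (H a)) s =
  - front_sum (fun a => front_sum (fun b => H b a)) s.
Proof.
elim: s H => [|a s IH] H /=; first by rewrite oppr0.
have E (K : V -> V -> seq V -> R) :
    front_sum (fun b u => K b a u - front_sum (fun c w => K b c (a :: w)) u) s =
    front_sum (fun b => K b a) s
    - front_sum (fun b => front_sum (fun c w => K b c (a :: w))) s.
  rewrite (_ : - front_sum _ s = -1 * front_sum (fun b => front_sum (fun c w => K b c (a :: w))) s); last by rewrite mulN1r.
  rewrite -front_sumZ -front_sumD.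
  by congr (front_sum _ s); apply/funext => b; apply/funext => t; rewrite mulN1r.
rewrite (E H) (E (fun b c => H c b)) (IH (fun b c w => H b c (a :: w))).
by rewrite -[RHS]opprK; ring.
Qed.

Lemma alt_sum_swap m F s :
  alt_sum m.+2 (fun t => if t is a :: b :: u then F (b :: a :: u) else F t) s =
  - alt_sum m.+2 F s.
Proof.
exact: (front_sum_swap (fun a b u => alt_sum m (fun w => F (b :: a :: w)) u)).
Qed.

(** Alternating the tail first changes nothing but the normalisation. *)
Lemma alt_sum_idem m F s : size s = m.+1 ->
  alt_sum m.+1
    (fun t => if t is a :: u then alt_sum m (fun w => F (a :: w)) u else 0) s =
  m`!%:R * alt_sum m.+1 F s.
Proof.
move=> sz /=; rewrite -front_sumZ; apply: (@front_sum_eq m) => // a t szt.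
by rewrite alt_sum_alternates //; apply: alternates_alt_sum.
Qed.

End Alternation.

Arguments alternates_swap {R V m F a b v}.
Arguments alternates_cons {R V m F a}.

Section SkewSym.
Context {R : realType} {V : Type}.
Implicit Types (F : seq V -> R) (s : seq V).

Lemma front_sumE x0 (G : V -> seq V -> R) s :
  front_sum G s = \sum_(j < size s)
     (-1) ^+ j * G (nth x0 s j) (take j s ++ drop j.+1 s).
Proof.
elim: s G => [|a s IH] G /=; first by rewrite big_ord0.
rewrite big_ord_recl /= expr0 mul1r drop0; congr (_ + _).
rewrite IH -sumrN; apply: eq_bigr => j _.
by rewrite /= /bump /= add1n exprS mulN1r mulNr.
Qed.

(** A permutation of m+1 points is the image of the first point together with
a permutation of the others. *)
Lemma sum_lift_perm m (f : 'S_m.+1 -> R) :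
  \sum_(p : 'S_m.+1) f p = \sum_j \sum_(p : 'S_m) f (lift_perm ord0 j p).
Proof.
rewrite pair_bigA /=.
apply: (reindex (fun jp : 'I_m.+1 * 'S_m => lift_perm ord0 jp.1 jp.2)).
apply/onW_bij/inj_card_bij; last first.
  by rewrite card_prod card_ord !card_Sn factS.
move=> [i p] [j q] /= /permP eq_pq.
have := eq_pq ord0; rewrite !lift_perm_id => ij; subst j; congr (_, _).
apply/permP => k; have := eq_pq (lift ord0 k); rewrite !lift_perm_lift.
exact: lift_inj.
Qed.

Lemma sum_perm_alt_sum x0 m F s : size s = m ->
  \sum_(p : 'S_m) (-1) ^+ odd_perm p * F [seq nth x0 s (p i) | i <- enum 'I_m] =
  alt_sum m F s.
Proof.
elim: m F s => [|m IH] F s sz /=.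
  rewrite (big_pred1 1%g) => [|p]; last first.
    by apply/esym/eqP/permP => -[].
  rewrite odd_perm1 expr0 mul1r; congr F.
  by rewrite (size0nil sz); case: (enum _) (size_enum_ord 0).
rewrite sum_lift_perm (front_sumE x0) sz; apply: eq_bigr => j _.
rewrite -(IH _ (take j s ++ drop j.+1 s)); last first.
  by rewrite size_cat size_take size_drop sz ltn_ord subSS subnKC // -ltnS.
rewrite mulr_sumr; apply: eq_bigr => p _.
rewrite odd_lift_perm /= signr_addb signr_odd -mulrA; congr (_ * (_ * F _)).
rewrite enum_ordSl /= lift_perm_id; congr (_ :: _).
rewrite -map_comp; apply: eq_map => i /=; rewrite lift_perm_lift.
rewrite nth_cat size_take sz ltn_ord /= /bump.
case: leqP => [le|lt]; last by rewrite nth_take.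
by rewrite nth_drop add1n addSn subnKC.
Qed.

(** Expanding the sum over permutations along the image of the first point gives
the recursion of alt_sum. *)
Lemma skewsymE F s : skewsym F s = (size s)`!%:R^-1 * alt_sum (size s) F s.
Proof.
rewrite /skewsym; congr (_ * _).
case: s => [|x0 s].
  rewrite /= (big_pred1 1%g) => [|p]; last by apply/esym/eqP/permP => -[].
  rewrite odd_perm1 expr0 mul1r /permute; congr F.
  by case: (enum _) (size_enum_ord 0).
rewrite -(@sum_perm_alt_sum x0) //; apply: eq_bigr => p _; congr (_ * F _).
by rewrite /permute; apply: eq_map => i; rewrite (tnth_nth x0).
Qed.

(** The tests are the transpositions of two neighbouring positions. *)
Lemma skew_alternates k F :
  (forall s (p : 'S_(size s)), size s = k ->
     F (permute p) = (-1) ^+ odd_perm p * F s) -> alternates k F.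
Proof.
move=> skF u a b v sz.
have lt0 : (size u < size (u ++ b :: a :: v))%N.
  by rewrite size_cat /= -addSnnS leq_addr.
have lt1 : ((size u).+1 < size (u ++ b :: a :: v))%N.
  by rewrite size_cat /= -2!addSnnS leq_addr.
have := skF (u ++ b :: a :: v) (tperm (Ordinal lt0) (Ordinal lt1)).
rewrite odd_tperm -val_eqE /= neq_ltn ltnSn /= expr1 mulN1r => <-; last first.
  by rewrite size_cat /= !addnS.
congr F; apply: (@eq_from_nth _ a); first by rewrite size_map size_enum_ord !size_cat.
move=> i; rewrite size_cat /= => lti.
have lti' : (i < size (u ++ b :: a :: v))%N by rewrite size_cat.
rewrite /permute (nth_map (Ordinal lti')) ?size_enum_ord //.
rewrite (tnth_nth a) /=.
have -> : nth (Ordinal lti') (enum 'I_(size (u ++ b :: a :: v))) i = Ordinal lti'.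
  by apply: val_inj; rewrite /= nth_enum_ord.
have [i0|ni0] := eqVneq i (size u).
  rewrite (_ : Ordinal lti' = Ordinal lt0); last exact: val_inj.
  by rewrite tpermL /= i0 !nth_cat ltnn subnn ltnNge leqnSn /= subSnn.
have [i1|ni1] := eqVneq i (size u).+1.
  rewrite (_ : Ordinal lti' = Ordinal lt1); last exact: val_inj.
  by rewrite tpermR /= i1 !nth_cat ltnn subnn ltnNge leqnSn /= subSnn.
rewrite tpermD -?val_eqE /= 1?eq_sym // !nth_cat.
case: ltnP => // le.
have lt : (size u < i)%N by rewrite ltn_neqAle eq_sym ni0.
have {}lt : ((size u).+1 < i)%N by rewrite ltn_neqAle eq_sym ni1.
by rewrite -(subnKC lt) !addSn -!addnS addKn.
Qed.
End SkewSym.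

(** * Derivations of list-indexed tensors *)

Section Derivation.
Context {R : comPzRingType} {V : finType}.
Implicit Types (A B : V -> V -> R) (T F : seq V -> R) (I J : seq V).

(** An endomorphism A of the index space acts on tensors as a derivation, one
index at a time.  Connection coefficients, curvatures and tractor endomorphisms
all act in this way, on coordinate indices or on tractor slots. *)
Fixpoint act A T I : R :=
  if I is a :: J then \sum_d A d a * T (d :: J) + act A (fun K => T (a :: K)) J
  else 0.

Lemma actE x0 A T I :
  act A T I = \sum_(j < size I) \sum_d A d (nth x0 I j) * T (set_nth x0 I j d).
Proof.
elim: I T => [|a I IH] T /=; first by rewrite big_ord0.
by rewrite big_ord_recl /= IH.
Qed.

Lemma act_cons A T a I :
  act A T (a :: I) = \sum_d A d a * T (d :: I) + act A (fun K => T (a :: K)) I.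
Proof. by []. Qed.

Lemma act_eq A B T T' I : (forall d b, A d b = B d b) ->
  (forall J, size J = size I -> T J = T' J) -> act A T I = act B T' I.
Proof.
move=> AB; elim: I T T' => [|a I IH] T T' TT' //=.
congr (_ + _); first by apply: eq_bigr => d _; rewrite AB TT'.
by apply: IH => J szJ; apply: TT'; rewrite /= szJ.
Qed.

Lemma act_sumr (K : finType) (c : K -> R) A (T : K -> seq V -> R) I :
  act A (fun J => \sum_i c i * T i J) I = \sum_i c i * act A (T i) I.
Proof.
elim: I T => [|a I IH] T /=; first by rewrite big1 // => i _; rewrite mulr0.
rewrite IH; under eq_bigr do rewrite mulr_sumr.
rewrite exchange_big -big_split /=; apply: eq_bigr => i _.
by rewrite mulrDr mulr_sumr; congr (_ + _); apply: eq_bigr => d _; ring.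
Qed.

Lemma act_suml (K : finType) (c : K -> R) (A : K -> V -> V -> R) T I :
  act (fun d b => \sum_i c i * A i d b) T I = \sum_i c i * act (A i) T I.
Proof.
elim: I T => [|a I IH] T /=; first by rewrite big1 // => i _; rewrite mulr0.
rewrite IH; under eq_bigr do rewrite mulr_suml.
rewrite exchange_big -big_split /=; apply: eq_bigr => i _.
by rewrite mulrDr mulr_sumr; congr (_ + _); apply: eq_bigr => d _; ring.
Qed.

Lemma actDr A T T' I : act A (fun J => T J + T' J) I = act A T I + act A T' I.
Proof.
elim: I T T' => [|a I IH] T T' /=; first by rewrite addr0.
by rewrite IH; under eq_bigr do rewrite mulrDr; rewrite big_split /=; ring.
Qed.

Lemma actZr A c T I : act A (fun J => c * T J) I = c * act A T I.
Proof.
elim: I T => [|a I IH] T /=; first by rewrite mulr0.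
rewrite IH mulrDr mulr_sumr; congr (_ + _).
by apply: eq_bigr => d _; ring.
Qed.

Lemma actBr A T T' I : act A (fun J => T J - T' J) I = act A T I - act A T' I.
Proof.
rewrite -[- act A T' I]mulN1r -actZr -actDr.
by apply: act_eq => // J _; rewrite mulN1r.
Qed.

Lemma actBl A B T I :
  act (fun d b => A d b - B d b) T I = act A T I - act B T I.
Proof.
elim: I T => [|a I IH] T /=; first by rewrite subr0.
by rewrite IH; under eq_bigr do rewrite mulrBl; rewrite sumrB /=; ring.
Qed.

Lemma actZl A c T I : act (fun d b => c * A d b) T I = c * act A T I.
Proof.
elim: I T => [|a I IH] T /=; first by rewrite mulr0.
rewrite IH mulrDr mulr_sumr; congr (_ + _).
by apply: eq_bigr => d _; ring.
Qed.

Lemma act0l A T I : (forall d b, A d b = 0) -> act A T I = 0.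
Proof.
move=> A0; rewrite (@act_eq _ (fun d b => 0 * A d b) _ T) ?actZl ?mul0r // => d b.
by rewrite A0 mulr0.
Qed.

Lemma alternates_act m A T : alternates m T -> alternates m (act A T).
Proof.
move=> altT u; elim: u m T altT => [|c u IH] m T altT a b v sz.
  have sumE x y : \sum_d A d x * T (d :: y :: v) = - \sum_d A d x * T (y :: d :: v).
    by rewrite -sumrN; apply: eq_bigr => d _; rewrite (alternates_swap altT) ?mulrN.
  rewrite /= (sumE a b) (sumE b a).
  rewrite (@act_eq A A (fun K => T (a :: b :: K)) (fun K => -1 * T (b :: a :: K))) //.
    by rewrite actZr; ring.
  by move=> J szJ; rewrite mulN1r (alternates_swap altT) // szJ.
rewrite [act A T _]/= [act A T (_ ++ b :: _)]/= opprD -sumrN.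
case: m altT sz => [|m] // altT sz; rewrite /= addSn in sz.
congr (_ + _).
  by apply: eq_bigr => d _; rewrite (altT (d :: u)) ?mulrN //= addSn sz.
apply: (IH m); [exact: alternates_cons altT | by case: sz].
Qed.

(** The derivation action is a representation of the Lie algebra of matrices
(with the order of the product that lower indices give).  This is where the
quadratic terms of the Riemann tensor come from: contributions of two different
indices commute and cancel. *)
Lemma act_comm A B T I :
  act A (act B T) I - act B (act A T) I =
  act (fun e a => \sum_d (A d a * B e d - B d a * A e d)) T I.
Proof.
elim: I T => [|a I IH] T /=; first by rewrite subr0.
rewrite !actDr !act_sumr -IH.
under eq_bigr do rewrite mulrDr mulr_sumr.
rewrite big_split exchange_big /=.
under [X in _ - (X + _)]eq_bigr do rewrite mulrDr mulr_sumr.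
rewrite [X in _ - (X + _)]big_split [X in _ - (X + _ + _)]exchange_big /=.
rewrite (_ : \sum_d _ * T (d :: I) = \sum_d (\sum_i A i a * (B d i * T (d :: I)) -
   \sum_i B i a * (A d i * T (d :: I)))); last first.
  apply: eq_bigr => d _; rewrite mulr_suml -sumrB.
  by apply: eq_bigr => i _; ring.
by rewrite sumrB; ring.
Qed.

Definition wedge1 (h : V -> R) F I : R := front_sum (fun a t => h a * F t) I.

Lemma wedge1_cons h F a I :
  wedge1 h F (a :: I) = h a * F I - wedge1 h (fun t => F (a :: t)) I.
Proof. by []. Qed.

Lemma wedge1_eq h h' F F' I : (forall a, h a = h' a) ->
  (forall t, (size t).+1 = size I -> F t = F' t) -> wedge1 h F I = wedge1 h' F' I.
Proof.
case: I => // b I hh' FF'; apply: (@front_sum_eq _ _ (size I)) => // a t szt.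
by rewrite hh' FF' // szt.
Qed.

Lemma wedge1_sumr (K : finType) (c : K -> R) h (F : K -> seq V -> R) I :
  wedge1 h (fun J => \sum_i c i * F i J) I = \sum_i c i * wedge1 h (F i) I.
Proof.
rewrite /wedge1; under [RHS]eq_bigr do rewrite -front_sumZ.
rewrite -front_sum_sum; congr (front_sum _ I).
by apply/funext => a; apply/funext => t; rewrite mulr_sumr; apply: eq_bigr => i _; ring.
Qed.

Lemma wedge1_suml (K : finType) (c : K -> R) (h : K -> V -> R) F I :
  wedge1 (fun a => \sum_i c i * h i a) F I = \sum_i c i * wedge1 (h i) F I.
Proof.
rewrite /wedge1; under [RHS]eq_bigr do rewrite -front_sumZ.
rewrite -front_sum_sum; congr (front_sum _ I).
by apply/funext => a; apply/funext => t; rewrite mulr_suml; apply: eq_bigr => i _; ring.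
Qed.

Lemma wedge1Dr h F F' I :
  wedge1 h (fun t => F t + F' t) I = wedge1 h F I + wedge1 h F' I.
Proof.
rewrite /wedge1 -front_sumD; congr (front_sum _ I).
by apply/funext => a; apply/funext => t; rewrite mulrDr.
Qed.

Lemma wedge1Zr h c F I : wedge1 h (fun t => c * F t) I = c * wedge1 h F I.
Proof.
rewrite /wedge1 -front_sumZ; congr (front_sum _ I).
by apply/funext => a; apply/funext => t; ring.
Qed.

Lemma wedge1Br h F F' I :
  wedge1 h (fun t => F t - F' t) I = wedge1 h F I - wedge1 h F' I.
Proof.
rewrite -[- wedge1 h F' I]mulN1r -wedge1Zr -wedge1Dr.
by apply: wedge1_eq => // J _; rewrite mulN1r.
Qed.

Lemma wedge1Dl h h' F I :
  wedge1 (fun a => h a + h' a) F I = wedge1 h F I + wedge1 h' F I.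
Proof.
rewrite /wedge1 -front_sumD; congr (front_sum _ I).
by apply/funext => a; apply/funext => t; rewrite mulrDl.
Qed.

Lemma wedge1Zl h c F I : wedge1 (fun a => c * h a) F I = c * wedge1 h F I.
Proof.
rewrite /wedge1 -front_sumZ; congr (front_sum _ I).
by apply/funext => a; apply/funext => t; ring.
Qed.

Lemma wedge1_0l h F I : (forall a, h a = 0) -> wedge1 h F I = 0.
Proof.
move=> h0; rewrite (@wedge1_eq _ (fun a => 0 * h a) _ F) ?wedge1Zl ?mul0r // => a.
by rewrite h0 mulr0.
Qed.

Lemma act0r A T I :
  (forall J, size J = size I -> T J = 0) -> act A T I = 0.
Proof.
move=> T0; rewrite (@act_eq A A T (fun J => 0 * T J)) ?actZr ?mul0r // => J szJ.
by rewrite T0 ?mulr0.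
Qed.

Lemma wedge1_0r h F I :
  (forall t, (size t).+1 = size I -> F t = 0) -> wedge1 h F I = 0.
Proof.
move=> F0; rewrite (@wedge1_eq _ h _ (fun t => 0 * F t)) ?wedge1Zr ?mul0r //.
by move=> t szt; rewrite mul0r F0.
Qed.

Lemma alternates_wedge1 m h F :
  alternates m F -> alternates m.+1 (wedge1 h F).
Proof.
move=> altF; apply: alternates_front_sum => a u b c v sz.
by rewrite altF // mulrN.
Qed.

(** Leibniz rule for the wedge product with a one-form. *)
Lemma act_wedge1 A h F I :
  act A (wedge1 h F) I =
  wedge1 (fun a => \sum_d A d a * h d) F I + wedge1 h (act A F) I.
Proof.
elim: I F => [|a I IH] F /=; first by rewrite /wedge1 /= addr0.
rewrite !wedge1_cons /= wedge1Dr wedge1_sumr.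
rewrite (_ : act A _ I = act A (fun J => h a * F J + -1 * wedge1 h (fun t => F (a :: t)) J) I); last first.
  by apply: act_eq => // J _; rewrite wedge1_cons mulN1r.
rewrite actDr !actZr IH.
under eq_bigr do rewrite wedge1_cons mulrBr mulrA.
by rewrite sumrB -mulr_suml; ring.
Qed.

(** Contracting g_{p [.} F_{q ...]} with the inverse metric: every index of F
is replaced by itself once, with the sign restored by skewness. *)
Lemma trace_wedge1 m (g G : V -> V -> R) F I :
  (forall q b, \sum_p G p q * g p b = (q == b)%:R) ->
  alternates m F -> size I = m ->
  \sum_p \sum_q G p q * wedge1 (g p) (fun J => F (q :: J)) I = m%:R * F I.
Proof.
move=> gG; elim: m F I => [|m IH] F [|b I] // altF sz.
  rewrite mul0r big1 // => p _; rewrite big1 // => q _.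
  by rewrite /wedge1 /= mulr0.
case: sz => sz.
transitivity (\sum_q (\sum_p G p q * g p b) * F (q :: I) +
   \sum_p \sum_q G p q * wedge1 (g p) (fun J => F (b :: q :: J)) I).
  under [X in _ = X + _]eq_bigr do rewrite mulr_suml.
  rewrite [X in _ = X + _]exchange_big -big_split /=; apply: eq_bigr => p _.
  rewrite -big_split; apply: eq_bigr => q _ /=.
  rewrite wedge1_cons (@wedge1_eq _ (g p) _ (fun J => -1 * F (b :: q :: J))) //.
    by rewrite wedge1Zr; ring.
  by move=> t szt; rewrite mulN1r (alternates_swap altF) // szt sz.
rewrite (IH (fun J => F (b :: J))) //; last exact: alternates_cons altF.
rewrite (bigD1 b) //= gG eqxx big1 => [|q /negbTE qb]; last by rewrite gG qb mul0r.
by rewrite mul1r addr0 -[m.+1%:R]natr1; ring.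
Qed.

Lemma alternates_move m F u a v : alternates m F ->
  (size u + size v).+1 = m -> F (u ++ a :: v) = (-1) ^+ size u * F (a :: u ++ v).
Proof.
elim: u m F => [|c u IH] [|m] F altF //= sz; first by rewrite mul1r.
rewrite (IH m (fun s => F (c :: s))); last 2 first.
- exact: alternates_cons altF.
- by case: sz; rewrite addSn.
rewrite (alternates_swap altF) ?exprS; first by ring.
by rewrite size_cat; case: sz; rewrite addSn => ->.
Qed.

End Derivation.

(** * Tractor slots *)

Section Slots.
Context {R : realType} {n : nat}.
Implicit Types (T : seq (slot n) -> R) (S : seq (slot n)) (b : seq 'I_n).

Notation Y := (slotY n).
Notation X := (slotX n).
Notation Z := (@slotZ n).

Lemma sum_slot (f : slot n -> R) : \sum_s f s = f Y + \sum_a f (Z a) + f X.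
Proof.
rewrite big_sumType /= big_sumType /=; congr (_ + _ + _).
  by rewrite (big_pred1 tt) // => -[].
by rewrite (big_pred1 tt) // => -[].
Qed.

Definition isZ (s : slot n) : bool := if s is inl (inr _) then true else false.

Lemma all_isZ S : all isZ S -> exists b, S = map Z b.
Proof.
elim: S => [|[[[]|a]|[]] S IH] //=; first by exists [::].
by move=> /IH [b ->]; exists (a :: b).
Qed.

(** A skew tractor component can be sorted: either some slot is Y, or exactly
one is X (two of them give zero), or all are Z.  So three kinds of components
determine a skew tractor. *)
Lemma slot_vanish m T : alternates m T ->
  (forall S, (size S).+1 = m -> T (Y :: S) = 0) ->
  (forall b, (size b).+1 = m -> T (X :: map Z b) = 0) ->
  (forall b, size b = m -> T (map Z b) = 0) ->
  forall S, size S = m -> T S = 0.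
Proof.
move=> altT TY TX TZ S szS.
have [/all_isZ[b Sb]|] := boolP (all isZ S).
  by rewrite Sb TZ // -szS Sb size_map.
case/allPn => s /splitPr Ss; case: Ss szS => u v.
rewrite size_cat /= addnS => szS.
case: s => [[[]|a]|[]] // _; rewrite (alternates_move _ altT) //.
  by rewrite [T _]TY ?mulr0 // size_cat.
have [/all_isZ[b Sb]|] := boolP (all isZ (u ++ v)).
  by rewrite Sb [T _]TX ?mulr0 // -szS -size_cat Sb size_map.
case/allPn => s; rewrite -size_cat in szS; move: (u ++ v) szS => w szw.
move=> /splitPr Ss; case: Ss szw => u' v'.
rewrite size_cat /= addnS => szw.
case: s => [[[]|a]|[]] // _.
  rewrite (@alternates_move _ _ _ _ (X :: u') _ v' altT) //=.
  by rewrite [T _]TY ?mulr0 //= size_cat.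
rewrite (@alternates_move _ _ _ _ (X :: u') _ v' altT) //=.
suff -> : T (X :: X :: u' ++ v') = 0 by rewrite !mulr0.
by apply/eqP; rewrite -eqNr -(alternates_swap altT) // size_cat.
Qed.

(** The tractors with values in the part of the filtration that is orthogonal
to X. *)
Definition yfree m T := forall S, size S = m -> Y \in S -> T S = 0.

Lemma yfree_cons m s T : yfree m.+1 T -> yfree m (fun S => T (s :: S)).
Proof. by move=> yT S sz YS; apply: yT; rewrite ?inE ?YS ?orbT //= sz. Qed.

Lemma yfree_act m A T : (forall C, A C Y = 0) -> yfree m T -> yfree m (act A T).
Proof.
move=> AY; elim: m T => [|m IH] T yT [|s S] // [sz]; rewrite inE /=.
have [<- _|_ /= YS] := eqVneq Y s.
  rewrite big1 => [|C _]; last by rewrite AY mul0r.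
  rewrite (@act_eq _ _ A A _ (fun K => 0 * T K)) ?actZr ?mul0r ?addr0 //.
  by move=> J szJ; rewrite mul0r yT ?inE ?eqxx //= szJ sz.
rewrite big1 => [|C _]; last by rewrite yT ?mulr0 //= ?sz // inE YS orbT.
by rewrite (IH (fun K => T (s :: K))) ?addr0 //; apply: yfree_cons yT.
Qed.

(** On a skew tractor without Y components, an endomorphism produces a
Z...Z component in two ways: from its ZZ block, or by turning one X into a Z;
in the second case skewness brings the X to the front. *)
Lemma act_mapZ m A T b : yfree m T -> alternates m T -> size b = m ->
  act A T (map Z b) =
  act (fun d a => A (Z d) (Z a)) (fun K => T (map Z K)) b +
  wedge1 (fun a => A X (Z a)) (fun K => T (X :: map Z K)) b.
Proof.
elim: b m T => [|a b IH] [|m] T yT altT //= sz.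
  by rewrite /wedge1 /= addr0.
case: sz => sz.
rewrite sum_slot yT ?inE ?eqxx //=; last by rewrite size_map sz.
rewrite mulr0 add0r wedge1_cons (IH m (fun K => T (Z a :: K))) //; last 2 first.
- exact: yfree_cons yT.
- exact: alternates_cons altT.
rewrite (@wedge1_eq _ _ _ (fun a => A X (Z a)) (fun K => T [:: Z a, X & map Z K])
          (fun t => -1 * T (X :: map Z (a :: t)))) //; first by rewrite wedge1Zr; ring.
move=> t szt; rewrite mulN1r (alternates_swap altT) // size_map szt.
by rewrite sz.
Qed.

Lemma tZs_mapZ b b' : size b = size b' ->
  tZs (map Z b) b' = (b == b')%:R :> R.
Proof.
rewrite /tZs; elim: b b' => [|a b IH] [|a' b'] //=; first by rewrite big_nil.
by case=> sz; rewrite big_cons IH //= /tZ eqseq_cons -natrM mulnb.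
Qed.

Lemma sum_tZs_mapZ m (F : seq 'I_n -> R) b : size b = m ->
  \sum_(b' : m.-tuple 'I_n) tZs (map Z b) b' * F b' = F b.
Proof.
move=> sz; have szb : size b == m by apply/eqP.
rewrite (bigD1 (Tuple szb)) //= tZs_mapZ // eqxx mul1r.
rewrite big1 ?addr0 // => b' bb'; rewrite tZs_mapZ ?size_tuple //.
by rewrite -val_eqE /= eq_sym in bb'; rewrite (negbTE bb') mul0r.
Qed.

Lemma sum_tZs_nonZ m (F : seq 'I_n -> R) S : size S = m -> ~~ all isZ S ->
  \sum_(b' : m.-tuple 'I_n) tZs S b' * F b' = 0.
Proof.
move=> sz nZ; rewrite big1 // => b' _.
suff -> : tZs S b' = 0 :> R by rewrite mul0r.
have : size S = size b' by rewrite size_tuple.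
move: (tval b') => {F sz} {}b'; rewrite /tZs.
elim: S nZ b' => [|s S IH] //= + [|a b'] //= [sz].
rewrite big_cons /= negb_and => /orP[nZ|nZ].
  by case: s nZ => [[[]|?]|[]] // _; rewrite /tZ /= mul0r.
by rewrite IH ?mulr0.
Qed.

End Slots.

(** * Partial derivatives *)

Section SymmetricDerivatives.
Context {R : realType} {V : normedModType R}.
Implicit Types (f : V -> R) (x y u v : V).

Lemma is_derive_line f y u (s : R) : derivable f (s *: u + y) u ->
  is_derive s 1 (fun r : R => f (r *: u + y)) ('D_u f (s *: u + y)).
Proof.
move=> df; have E : (fun h : R => h^-1 *:
      (((fun r : R => f (r *: u + y)) \o shift s) (h *: 1) - f (s *: u + y))) =
    (fun h => h^-1 *: ((f \o shift (s *: u + y)) (h *: u) - f (s *: u + y))).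
  apply/funext => h /=; congr (_ *: (f _ - _)).
  by rewrite scalerDl [h%:A]mulr1 addrA.
by split; rewrite /derivable /derive E.
Qed.

(** The mean value theorem in the direction u turns the second difference of f
into a first difference of D_u f, which is linear up to a small error because
D_u f is differentiable at x. *)
Lemma second_difference f (U : set V) x u v : open U -> U x ->
  (forall y, U y -> differentiable f y) -> differentiable ('D_u f) x ->
  forall e : R, 0 < e -> exists2 d : R, 0 < d & forall t : R, 0 < t < d ->
    `|f (t *: u + (t *: v + x)) - f (t *: u + x) - f (t *: v + x) + f x
      - t ^+ 2 * 'D_v ('D_u f) x| <= e * t ^+ 2.
Proof.
move=> oU Ux df dF e e0; set F := 'D_u f.
(* The summand 1 keeps r positive when both directions vanish. *)
pose r := `|u| + `|v| + 1.
have r0 : 0 < r by rewrite /r ltr_wpDl // addr_ge0.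
have [_ /eqaddoP] := (diff_locallyP _ _).1 dF.
have e'0 : 0 < e / (2 * r) by rewrite divr_gt0 // mulr_gt0.
move=> /(_ _ e'0).
move=> /nbhs_normP[d1 /= d10 hF].
have /nbhs_normP[d2 /= d20 hU] := open_nbhs_nbhs (conj oU Ux).
exists (Num.min (d1 / r) (d2 / r)); first by rewrite lt_min !divr_gt0.
move=> t /andP[t0]; rewrite lt_min !ltr_pdivlMr // => /andP[td1 td2].
have small (a b : R) : 0 <= a <= t -> 0 <= b <= t ->
    `|a *: u + b *: v| <= t * r.
  move=> /andP[a0 ale] /andP[b0 ble].
  rewrite (le_trans (ler_normD _ _)) // !normrZ !ger0_norm // /r.
  rewrite mulrDr mulrDr mulr1; apply: ler_wpDr; first exact: ltW.
  by rewrite lerD // ler_wpM2r.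
have inU (a b : R) : 0 <= a <= t -> 0 <= b <= t -> U (a *: u + (b *: v + x)).
  move=> ha hb; rewrite addrA; apply: hU => /=.
  by rewrite opprD addrCA subrr addr0 normrN (le_lt_trans (small a b _ _)).
have inU0 (a : R) : 0 <= a <= t -> U (a *: u + x).
  by move=> ha; have := inU a 0 ha; rewrite scale0r add0r; apply; rewrite lexx ltW.
pose phi (s : R) := f (s *: u + (t *: v + x)) - f (s *: u + x).
pose dphi (s : R) := F (s *: u + (t *: v + x)) - F (s *: u + x).
have tt : 0 <= t <= t by rewrite lexx ltW.
have dphiE (s : R) : 0 <= s <= t -> is_derive s 1 phi (dphi s).
  move=> hs; apply: is_deriveB; apply: is_derive_line; apply: diff_derivable.
    exact/df/inU.
  exact/df/inU0.
have [||xi] := @MVT R phi dphi 0 t t0.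
- by move=> s; rewrite in_itv /= => /andP[s0 st]; apply: dphiE; rewrite !ltW.
- apply: derivable_within_continuous => s; rewrite in_itv /= => hs.
  by have [] := dphiE s hs.
rewrite in_itv /= subr0 => /andP[xi0 xit] phiE.
have hxi : 0 <= xi <= t by rewrite !ltW.
have dev (w : V) : `|w| <= t * r ->
    `|F (w + x) - F x - 'd F x w| <= e / (2 * r) * (t * r).
  move=> hw; apply: (@le_trans _ _ (e / (2 * r) * `|w|)); last first.
    by rewrite ler_pM2l // divr_gt0 // mulr_gt0.
  have := hF w; rewrite /= sub0r normrN opprD addrA; apply.
  exact: le_lt_trans td1.
have -> : 'D_v F x = 'd F x v by rewrite deriveE.
have -> : f (t *: u + (t *: v + x)) - f (t *: u + x) - f (t *: v + x) + f x =
    t * dphi xi.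
  by rewrite mulrC -phiE /phi !scale0r !add0r; ring.
have -> : t * dphi xi - t ^+ 2 * 'd F x v =
    t * ((F (xi *: u + t *: v + x) - F x - 'd F x (xi *: u + t *: v)) -
         (F (xi *: u + x) - F x - 'd F x (xi *: u))).
  by rewrite /dphi addrA !linearD !linearZ /= /GRing.scale /=; ring.
rewrite normrM gtr0_norm //.
have -> : e * t ^+ 2 = t * (e / (2 * r) * (t * r) + e / (2 * r) * (t * r)).
  by field; rewrite gt_eqF.
rewrite ler_pM2l // (le_trans (ler_normB _ _)) // lerD //; apply: dev.
  exact: small.
by have := small xi 0 hxi; rewrite scale0r addr0; apply; rewrite lexx ltW.
Qed.

(** The second difference is symmetric in u and v, and after division by t^2 it
tends to either mixed derivative. *)
Lemma derive_comm f (U : set V) x u v : open U -> U x ->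
  (forall y, U y -> differentiable f y) ->
  differentiable ('D_u f) x -> differentiable ('D_v f) x ->
  'D_v ('D_u f) x = 'D_u ('D_v f) x.
Proof.
move=> oU Ux df du dv; apply/eqP; rewrite -subr_eq0 -normr_le0.
apply/ler_addgt0Pl => e e0; rewrite addr0.
have e20 : 0 < e / 2 by rewrite divr_gt0.
have [d1 d10 h1] := second_difference v oU Ux df du e20.
have [d2 d20 h2] := second_difference u oU Ux df dv e20.
pose t := Num.min d1 d2 / 2.
have t0 : 0 < t by rewrite divr_gt0 // lt_min d10.
have tm : t < Num.min d1 d2 by rewrite /t; have := t0; rewrite /t; lra.
move: tm; rewrite lt_min => /andP[td1 td2].
have := h1 t; rewrite t0 td1 => /(_ isT) {}h1.
have := h2 t; rewrite t0 td2 => /(_ isT) {}h2.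
rewrite [t *: v + (t *: u + x)]addrCA in h2.
move: h1 h2; move: ('D_v ('D_u f) x) ('D_u ('D_v f) x) (f (t *: u + _)) => A B p.
move: (f (t *: u + x)) (f (t *: v + x)) (f x) => q r s.
move=> h1 h2; have t20 : 0 < t ^+ 2 by rewrite exprn_gt0.
rewrite -(ler_pM2l t20) -[X in X * _](gtr0_norm t20) -normrM.
have -> : t ^+ 2 * e = e / 2 * t ^+ 2 + e / 2 * t ^+ 2 by field.
apply: le_trans (lerD h2 h1); apply: le_trans (ler_normB _ _).
rewrite (_ : t ^+ 2 * (A - B) = p - r - q + s - t ^+ 2 * B
                               - (p - q - r + s - t ^+ 2 * A)) //.
by ring.
Qed.
End SymmetricDerivatives.

Section Partial.
Context {R : realType} {n : nat}.
Notation point := 'rV[R]_n.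
Implicit Types (f : point -> R) (x : point) (U : set point).

(** The product rule only needs the partial derivatives to exist.  This weaker
notion is stable under changing a function away from a point, which is how the
inverse metric is treated. *)
Definition pderivable f x := forall c : 'I_n, derivable f x (delta_mx ord0 c).

Lemma open_near U (P : point -> Prop) x : open U -> U x ->
  (forall y, U y -> P y) -> \near x, P x.
Proof. by move=> oU Ux UP; apply: filterS (open_nbhs_nbhs (conj oU Ux)). Qed.

Lemma partial_eq U f f' c x : open U -> U x ->
  (forall y, U y -> f y = f' y) -> partial c f x = partial c f' x.
Proof. by move=> oU Ux ff'; apply: near_eq_derive; apply: open_near Ux _. Qed.

Lemma pderivable_eq U f f' x : open U -> U x ->
  (forall y, U y -> f y = f' y) -> pderivable f x -> pderivable f' x.
Proof.
by move=> oU Ux ff' df c; apply: near_eq_derivable (df c); apply: open_near Ux _.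
Qed.

Lemma pderivable_cst (r : R) x : pderivable (fun=> r) x.
Proof. by move=> c; apply: derivable_cst. Qed.

Lemma pderivableD f f' x : pderivable f x -> pderivable f' x ->
  pderivable (fun y => f y + f' y) x.
Proof. by move=> df df' c; apply: derivableD. Qed.

Lemma pderivableB f f' x : pderivable f x -> pderivable f' x ->
  pderivable (fun y => f y - f' y) x.
Proof. by move=> df df' c; apply: derivableB. Qed.

Lemma pderivableM f f' x : pderivable f x -> pderivable f' x ->
  pderivable (fun y => f y * f' y) x.
Proof. by move=> df df' c; apply: derivableM. Qed.

Lemma pderivable_sum (I : finType) (f : I -> point -> R) x :
  (forall i, pderivable (f i) x) -> pderivable (fun y => \sum_i f i y) x.
Proof.
move=> df; elim: (index_enum I) => [|i r IH].
  by under eq_fun do rewrite big_nil; apply: pderivable_cst.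
have := pderivableD (df i) IH.
by congr (pderivable _ x); apply/funext => y; rewrite big_cons.
Qed.

Lemma pderivable_prod (I : finType) (f : I -> point -> R) x :
  (forall i, pderivable (f i) x) -> pderivable (fun y => \prod_i f i y) x.
Proof.
move=> df; elim: (index_enum I) => [|i r IH].
  by under eq_fun do rewrite big_nil; apply: pderivable_cst.
have := pderivableM (df i) IH.
by congr (pderivable _ x); apply/funext => y; rewrite big_cons.
Qed.

Lemma pderivable_det m (A : 'I_m -> 'I_m -> point -> R) x :
  (forall i j, pderivable (A i j) x) ->
  pderivable (fun y => \det (\matrix_(i, j) A i j y)) x.
Proof.
move=> dA; apply: pderivable_sum => s; apply: pderivableM.
  exact: pderivable_cst.
under eq_fun do under eq_bigr do rewrite mxE.
exact: (@pderivable_prod _ (fun i => A i (s i))).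
Qed.

Lemma partial_cst (r : R) c x : partial c (fun=> r) x = 0.
Proof. exact: derive_cst. Qed.

Lemma partialD f f' c x : pderivable f x -> pderivable f' x ->
  partial c (fun y => f y + f' y) x = partial c f x + partial c f' x.
Proof. by move=> df df'; apply: deriveD. Qed.

Lemma partialN f c x : pderivable f x ->
  partial c (fun y => - f y) x = - partial c f x.
Proof. by move=> df; apply: deriveN. Qed.

Lemma partialB f f' c x : pderivable f x -> pderivable f' x ->
  partial c (fun y => f y - f' y) x = partial c f x - partial c f' x.
Proof. by move=> df df'; apply: deriveB. Qed.

Lemma partialM f f' c x : pderivable f x -> pderivable f' x ->
  partial c (fun y => f y * f' y) x = partial c f x * f' x + f x * partial c f' x.
Proof.
move=> df df'; rewrite [LHS](deriveM (df c) (df' c)) addrC.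
exact: (congr1 (+%R^~ _) (mulrC _ _)).
Qed.

Lemma partialZ (r : R) f c x : pderivable f x ->
  partial c (fun y => r * f y) x = r * partial c f x.
Proof.
move=> df; rewrite (partialM c (@pderivable_cst r x) df).
by rewrite partial_cst mul0r add0r.
Qed.

Lemma partial_sum (I : finType) (f : I -> point -> R) c x :
  (forall i, pderivable (f i) x) ->
  partial c (fun y => \sum_i f i y) x = \sum_i partial c (f i) x.
Proof.
move=> df.
suff [] : pderivable (fun y => \sum_i f i y) x /\
          partial c (fun y => \sum_i f i y) x = \sum_i partial c (f i) x by [].
elim: (index_enum I) => [|i r [IH1 IH2]].
  under eq_fun do rewrite big_nil.
  by rewrite big_nil partial_cst; split=> //; apply: pderivable_cst.
have -> : (fun y => \sum_(j <- i :: r) f j y) =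
          (fun y => f i y + \sum_(j <- r) f j y).
  by apply/funext => y; rewrite big_cons.
have dD := pderivableD (df i) IH1.
by rewrite big_cons -IH2 -(partialD c (df i) IH1).
Qed.

Lemma smooth_differentiable U f x : smooth_on U f -> U x -> differentiable f x.
Proof. by move=> sf Ux; apply: (sf [::]). Qed.

Lemma smooth_pderivable U f x : smooth_on U f -> U x -> pderivable f x.
Proof. by move=> sf Ux c; apply/diff_derivable/(smooth_differentiable sf). Qed.

Lemma smooth_partial U f c : smooth_on U f -> smooth_on U (partial c f).
Proof. by move=> sf s x Ux; have := sf (rcons s c) x Ux; rewrite foldr_rcons. Qed.

Lemma partial_comm U f c d x : open U -> U x -> smooth_on U f ->
  partial c (partial d f) x = partial d (partial c f) x.
Proof.
move=> oU Ux sf; apply: (derive_comm oU Ux).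
- by move=> y Uy; apply: smooth_differentiable sf Uy.
- exact: smooth_differentiable (smooth_partial _ sf) Ux.
- exact: smooth_differentiable (smooth_partial _ sf) Ux.
Qed.

End Partial.

(** * The Levi-Civita connection and its curvature *)

Lemma sum_delta (R : pzRingType) (I : finType) (i : I) (f : I -> R) :
  \sum_j (i == j)%:R * f j = f i.
Proof.
rewrite (bigD1 i) //= eqxx mul1r big1 ?addr0 // => j ji.
by rewrite eq_sym (negbTE ji) mul0r.
Qed.

(** Derivatives, sums and connection coefficients enter the ring identities
below as indeterminates; they are replaced by variables first. *)
Ltac abstract_atoms :=
  repeat match goal with
  | |- context [?t] =>
      lazymatch t with
      | bigop.body _ _ _ => idtac
      | front_sum _ _ => idtac
      | wedge1 _ _ _ => idtac
      | act _ _ _ => idtac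
      | partial _ _ _ => idtac
      | christoffel _ _ _ _ _ => idtac
      | ginv _ _ _ _ => idtac
      | riemann_up _ _ _ _ _ _ => idtac
      | riemann _ _ _ _ _ _ => idtac
      end;
      let h := fresh "h" in move: t => h
  end.
Ltac abstract_ring := abstract_atoms; ring.

(** The octahedron argument: signed sums of the four cyclic identities leave only
two opposite vertices. *)
Lemma pair_symmetry (R : realFieldType) (I : Type) (r : I -> I -> I -> I -> R) :
  (forall a b c d, r a b c d = - r b a c d) ->
  (forall a b c d, r a b c d = - r a b d c) ->
  (forall a b c d, r a b c d + r b d c a + r d a c b = 0) ->
  forall a b c d, r a b c d = r c d a b.
Proof.
move=> skl skr cyc a b c d.
have := cyc a b c d; rewrite (skr b d c a) (skl d a c b) (skr a d c b).
have := cyc b c d a; rewrite (skr b c d a) (skl c a d b) (skr a c d b) (skr a b d c).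
have := cyc c d a b; rewrite (skl d b a c).
have := cyc d a b c; rewrite (skl d a b c) (skr c d b a).
lra.
Qed.

Section Covariant.
Context {R : realType} {n : nat}.
Notation point := 'rV[R]_n.
Notation tensor := (seq 'I_n -> point -> R).

Lemma pderivable_act (A : 'I_n -> 'I_n -> point -> R) (T : tensor) I (x : point) :
  (forall d b, pderivable (A d b) x) ->
  (forall J, size J = size I -> pderivable (T J) x) ->
  pderivable (fun y => act (fun d b => A d b y) (T ^~ y) I) x.
Proof.
move=> dA; elim: I T => [|a I IH] T dT /=; first exact: pderivable_cst.
apply: pderivableD.
  by apply: pderivable_sum => d; apply: pderivableM => //; apply: dT.
by apply: (IH (fun K => T (a :: K))) => J szJ; apply: dT; rewrite /= szJ.
Qed.

Lemma partial_act (A : 'I_n -> 'I_n -> point -> R) (T : tensor) c I (x : point) :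
  (forall d b, pderivable (A d b) x) ->
  (forall J, size J = size I -> pderivable (T J) x) ->
  partial c (fun y => act (fun d b => A d b y) (T ^~ y) I) x =
  act (fun d b => partial c (A d b) x) (T ^~ x) I +
  act (fun d b => A d b x) (fun J => partial c (T J) x) I.
Proof.
move=> dA; elim: I T => [|a I IH] T dT /=; first by rewrite partial_cst addr0.
have dI d : pderivable (T (d :: I)) x by apply: dT.
have dJ J : size J = size I -> pderivable (T (a :: J)) x.
  by move=> szJ; apply: dT; rewrite /= szJ.
have dM d := pderivableM (dA d a) (dI d).
rewrite (partialD c (pderivable_sum dM) (pderivable_act dA dJ)).
rewrite (partial_sum c dM) /= (IH (fun K => T (a :: K)) dJ).
under eq_bigr => d _ do rewrite (partialM c (dA d a) (dI d)).
by rewrite big_split /=; abstract_ring.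
Qed.

Lemma pderivable_wedge1 (h : 'I_n -> point -> R) (F : tensor) I (x : point) :
  (forall a, pderivable (h a) x) ->
  (forall J, (size J).+1 = size I -> pderivable (F J) x) ->
  pderivable (fun y => wedge1 (h ^~ y) (F ^~ y) I) x.
Proof.
move=> dh; elim: I F => [|a I IH] F dF; first exact: pderivable_cst.
apply: pderivableB; first by apply: pderivableM => //; apply: dF.
by apply: (IH (fun K => F (a :: K))) => J szJ; apply: dF; rewrite /= szJ.
Qed.

Lemma partial_wedge1 (h : 'I_n -> point -> R) (F : tensor) c I (x : point) :
  (forall a, pderivable (h a) x) ->
  (forall J, (size J).+1 = size I -> pderivable (F J) x) ->
  partial c (fun y => wedge1 (h ^~ y) (F ^~ y) I) x =
  wedge1 (fun a => partial c (h a) x) (F ^~ x) I +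
  wedge1 (h ^~ x) (fun J => partial c (F J) x) I.
Proof.
move=> dh; elim: I F => [|a I IH] F dF.
  by rewrite /wedge1 /= partial_cst addr0.
have dI : pderivable (F I) x by apply: dF.
have dJ J : (size J).+1 = size I -> pderivable (F (a :: J)) x.
  by move=> szJ; apply: dF; rewrite /= szJ.
rewrite (partialB c (pderivableM (dh a) dI) (pderivable_wedge1 dh dJ)).
rewrite (partialM c (dh a) dI) (IH (fun K => F (a :: K)) dJ) !wedge1_cons.
abstract_ring.
Qed.

Section Metric.
Context (U : set point) (g : 'I_n -> 'I_n -> point -> R).
Context (oU : open U) (g_smooth : forall a b, smooth_on U (g a b)).
Context (g_sym : forall a b x, U x -> g a b x = g b a x).
Context (g_nondeg : forall x, U x -> \det (\matrix_(i, j) g i j x) != 0).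

Notation Gam := (christoffel g).
Let gm (x : point) : 'M[R]_n := \matrix_(i, j) g i j x.

Lemma gm_unit x : U x -> gm x \in unitmx.
Proof. by move=> Ux; rewrite unitmxE unitfE; apply: g_nondeg. Qed.

Lemma ginv_mul x a b : U x -> \sum_e ginv g a e x * g e b x = (a == b)%:R.
Proof.
move=> Ux; have /matrixP/(_ a b) := mulVmx (gm_unit Ux).
by rewrite !mxE => <-; apply: eq_bigr => e _; rewrite !mxE.
Qed.

Lemma mul_ginv x a b : U x -> \sum_e g a e x * ginv g e b x = (a == b)%:R.
Proof.
move=> Ux; have /matrixP/(_ a b) := mulmxV (gm_unit Ux).
by rewrite !mxE => <-; apply: eq_bigr => e _; rewrite !mxE.
Qed.

Lemma ginv_sym x a b : U x -> ginv g a b x = ginv g b a x.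
Proof.
move=> Ux; rewrite /ginv -/(gm x) -[in RHS](trmxK (gm x)).
have -> : (gm x)^T = gm x by apply/matrixP => i j; rewrite !mxE g_sym.
by rewrite -trmx_inv mxE.
Qed.

Lemma pderivable_g x a b : U x -> pderivable (g a b) x.
Proof. by move=> Ux; apply: smooth_pderivable (g_smooth a b) Ux. Qed.
Arguments pderivable_g {x} a b.

Lemma pderivable_partial_g x c a b : U x -> pderivable (partial c (g a b)) x.
Proof.
by move=> Ux; apply: smooth_pderivable (smooth_partial c (g_smooth a b)) Ux.
Qed.
Arguments pderivable_partial_g {x} c a b.

(** On U the inverse metric is given by Cramer's rule, hence is rational in the
components of g. *)
Lemma pderivable_ginv x a b : U x -> pderivable (ginv g a b) x.
Proof.
move=> Ux; pose f y := (\det (gm y))^-1 * cofactor (gm y) b a.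
have ddet : pderivable (fun y => \det (gm y)) x.
  by apply: pderivable_det => i j; apply: pderivable_g.
apply: (@pderivable_eq _ _ U f _ x oU Ux) => [y Uy|].
  by rewrite /f /ginv /invmx -/(gm y) (gm_unit Uy) !mxE.
apply: pderivableM.
  by move=> c; apply: derivableV (ddet c); apply: g_nondeg.
apply: pderivableM; first exact: pderivable_cst.
have := @pderivable_det _ _ _ (fun i j y => g (lift b i) (lift a j) y) x.
move=> /(_ (fun i j => pderivable_g _ _ Ux)).
congr (pderivable _ x); apply/funext => y; congr (\det _).
by apply/matrixP => i j; rewrite !mxE.
Qed.
Arguments pderivable_ginv {x} a b.

Lemma pderivable_christoffel x d c b : U x -> pderivable (Gam d c b) x.
Proof.
move=> Ux; apply: pderivableM; first exact: pderivable_cst.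
apply: pderivable_sum => e; apply: pderivableM; first exact: pderivable_ginv.
apply: pderivableB; last exact: pderivable_partial_g.
by apply: pderivableD; apply: pderivable_partial_g.
Qed.
Arguments pderivable_christoffel {x} d c b.

Lemma partial_g_sym x c a b : U x -> partial c (g a b) x = partial c (g b a) x.
Proof. by move=> Ux; apply: partial_eq oU Ux _ => y Uy; apply: g_sym. Qed.

Lemma christoffel_sym x d c b : U x -> Gam d c b x = Gam d b c x.
Proof.
move=> Ux; congr (_ * _); apply: eq_bigr => e _.
by rewrite (partial_g_sym e c b Ux); congr (_ * _); abstract_ring.
Qed.

(** Lowering the upper index removes the inverse metric. *)
Lemma christoffel_low x a c b : U x ->
  \sum_d g a d x * Gam d c b x =
  2^-1 * (partial c (g b a) x + partial b (g c a) x - partial a (g c b) x).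
Proof.
move=> Ux; under eq_bigr do rewrite /christoffel mulrCA mulr_sumr.
rewrite -mulr_sumr exchange_big /=; congr (_ * _).
rewrite -[RHS](sum_delta a (fun e =>
  partial c (g b e) x + partial b (g c e) x - partial e (g c b) x)).
apply: eq_bigr => e _; rewrite -(mul_ginv a e Ux) mulr_suml.
by apply: eq_bigr => d _; rewrite mulrA.
Qed.

(** This is nabla g = 0, solved for the partial derivative. *)
Lemma partial_metric x c a b : U x ->
  partial c (g a b) x =
  \sum_d Gam d c a x * g d b x + \sum_d Gam d c b x * g a d x.
Proof.
move=> Ux.
have -> : \sum_d Gam d c a x * g d b x = \sum_d g b d x * Gam d c a x.
  by apply: eq_bigr => d _; rewrite mulrC g_sym.
have -> : \sum_d Gam d c b x * g a d x = \sum_d g a d x * Gam d c b x.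
  by apply: eq_bigr => d _; rewrite mulrC.
rewrite !christoffel_low // (partial_g_sym a c b Ux) (partial_g_sym b c a Ux).
by rewrite (partial_g_sym c b a Ux); field.
Qed.

(** This is nabla g^{-1} = 0: differentiate g^{-1} g = 1 and use the formula
for the derivative of g. *)
Lemma partial_ginv x c p q : U x ->
  partial c (ginv g p q) x =
  - \sum_d Gam p c d x * ginv g d q x - \sum_d Gam q c d x * ginv g p d x.
Proof.
move=> Ux.
pose dg : 'M[R]_n := \matrix_(i, j) partial c (g i j) x.
pose dgi : 'M[R]_n := \matrix_(i, j) partial c (ginv g i j) x.
pose Ga : 'M[R]_n := \matrix_(i, j) Gam i c j x.
have dgE : dg = Ga^T *m gm x + gm x *m Ga.
  apply/matrixP => i j; rewrite !mxE partial_metric //; congr (_ + _);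
    by apply: eq_bigr => d _; rewrite !mxE // mulrC.
have Leib : dgi *m gm x + invmx (gm x) *m dg = 0.
  apply/matrixP => i j; rewrite !mxE.
  transitivity (partial c (fun y => \sum_e ginv g i e y * g e j y) x); last first.
    rewrite (@partial_eq _ _ U _ (fun=> (i == j)%:R)) ?partial_cst // => y Uy.
    exact: ginv_mul.
  rewrite partial_sum => [|e]; last first.
    by apply: pderivableM; [apply: pderivable_ginv | apply: pderivable_g].
  rewrite -big_split; apply: eq_bigr => e _ /=; rewrite !mxE.
  by rewrite (partialM c (pderivable_ginv _ _ Ux) (pderivable_g _ _ Ux)).
have dgiE : dgi = - (Ga *m invmx (gm x)) - invmx (gm x) *m Ga^T.
  move/(congr1 (mulmx^~ (invmx (gm x)))): Leib.
  rewrite dgE mulmxDl mul0mx mulmxK ?gm_unit // mulmxDr mulmxDl.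
  rewrite !mulmxA (mulmxK (gm_unit Ux)) (mulVmx (gm_unit Ux)) mul1mx.
  by move/eqP; rewrite addr_eq0 => /eqP ->; rewrite opprD addrC.
move/matrixP/(_ p q): dgiE; rewrite !mxE => ->.
by congr (- _ - _); apply: eq_bigr => d _; rewrite !mxE // mulrC.
Qed.

Definition cov d (T : tensor) : tensor := fun I x =>
  partial d (T I) x - act (fun e b => Gam e d b x) (T ^~ x) I.

(** The covariant derivative as a tensor with one more index, so that it can be
differentiated again. *)
Definition cov_tensor (T : tensor) : tensor := fun J x =>
  if J is c :: K then cov c T K x else 0.

Definition smooth_tensor m (T : tensor) :=
  forall J, size J = m -> smooth_on U (T J).

Definition pderivable_tensor m (T : tensor) :=
  forall J x, size J = m -> U x -> pderivable (T J) x.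

Lemma smooth_pderivable_tensor m T : smooth_tensor m T -> pderivable_tensor m T.
Proof. by move=> sT J x szJ; apply/smooth_pderivable/sT. Qed.

Lemma nabla_cov d (T : tensor) I x :
  nabla g d (fun L _ => T L) I [::] x = cov d T I x.
Proof. by rewrite /nabla big_ord0 addr0 /cov (actE d). Qed.

Lemma cov_eq d T T' I x : U x ->
  (forall J y, size J = size I -> U y -> T J y = T' J y) ->
  cov d T I x = cov d T' I x.
Proof.
move=> Ux TT'; congr (_ - _).
  by apply: partial_eq oU Ux _ => y Uy; apply: TT'.
by apply: act_eq => // J szJ; apply: TT'.
Qed.

Lemma covD d m T T' I x : U x -> size I = m ->
  pderivable_tensor m T -> pderivable_tensor m T' ->
  cov d (fun J y => T J y + T' J y) I x = cov d T I x + cov d T' I x.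
Proof.
move=> Ux szI dT dT'; rewrite /cov (partialD d (dT I x szI Ux) (dT' I x szI Ux)).
by rewrite actDr; abstract_ring.
Qed.

Lemma covZ d m (r : R) T I x : U x -> size I = m -> pderivable_tensor m T ->
  cov d (fun J y => r * T J y) I x = r * cov d T I x.
Proof.
move=> Ux szI dT; rewrite /cov (partialZ r d (dT I x szI Ux)) actZr.
by rewrite mulrBr.
Qed.

Lemma alternates_cov d m T x : U x -> pderivable_tensor m T ->
  (forall y, U y -> alternates m (T ^~ y)) -> alternates m (cov d T ^~ x).
Proof.
move=> Ux dT altT u a b v sz.
have szE c e : size (u ++ c :: e :: v) = m by rewrite size_cat /= -sz !addnS.
rewrite /cov (alternates_act _ (altT x Ux)) //.
rewrite (partial_eq _ oU Ux (fun y Uy => altT y Uy u a b v sz)) partialN.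
  by rewrite opprD.
exact: dT.
Qed.

Lemma smooth_pderivable_cov m d T : smooth_tensor m T ->
  pderivable_tensor m (cov d T).
Proof.
move=> sT J x szJ Ux; apply: pderivableB.
  exact: smooth_pderivable (smooth_partial d (sT J szJ)) Ux.
apply: pderivable_act => [e b|K szK]; first exact: pderivable_christoffel.
by apply: smooth_pderivable Ux; apply: sT; rewrite szK.
Qed.

Lemma smooth_pderivable_cov_tensor m T : smooth_tensor m T ->
  pderivable_tensor m.+1 (cov_tensor T).
Proof.
move=> sT [|d J] x //= [szJ] Ux; exact: (smooth_pderivable_cov sT szJ Ux).
Qed.

(** The terms with one derivative of T cancel in pairs, the second partial
derivatives commute, and the Christoffel symbols in the derivative index drop out
because the connection is torsion-free.  What is left acts on T as a
derivation. *)
Lemma ricci_identity m T c d I x : U x -> smooth_tensor m T -> size I = m ->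
  cov d (cov_tensor T) (c :: I) x - cov c (cov_tensor T) (d :: I) x =
  - act (fun e b => riemann_up g d c e b x) (T ^~ x) I.
Proof.
move=> Ux sT szI.
have dT J : size J = size I -> pderivable (T J) x.
  by rewrite szI => szJ; apply: smooth_pderivable (sT J szJ) Ux.
have dpT e J : size J = size I -> pderivable (partial e (T J)) x.
  rewrite szI => szJ.
  exact: smooth_pderivable (smooth_partial e (sT J szJ)) Ux.
have dG c' e b : pderivable (Gam e c' b) x by apply: pderivable_christoffel.
pose G c' e b := Gam e c' b x; pose dG' d' c' e b := partial d' (Gam e c' b) x.
pose T0 := T ^~ x; pose dT' d' J := partial d' (T J) x.
pose S c' d' := \sum_e Gam e d' c' x * cov_tensor T (e :: I) x.
have E c' d' : cov d' (cov_tensor T) (c' :: I) x =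
    partial d' (partial c' (T I)) x - act (dG' d' c') T0 I - act (G c') (dT' d') I
    - S c' d' - act (G d') (dT' c') I + act (G d') (act (G c') T0) I.
  rewrite {1}/cov /= /cov.
  rewrite (partialB d' (dpT c' I erefl) (pderivable_act (dG c') dT)).
  rewrite (partial_act _ (dG c') dT) actBr.
  by rewrite !opprD opprK !addrA.
have Ssym : S d c = S c d by apply: eq_bigr => e _; rewrite christoffel_sym.
have curvE e b : riemann_up g d c e b x = dG' d c e b - dG' c d e b
    - \sum_f (G d f b * G c e f - G c f b * G d e f).
  rewrite -sumrN; congr (_ + _); apply: eq_bigr => f _.
  by rewrite opprB [X in X - _]mulrC [X in _ - X]mulrC.
rewrite !E (partial_comm d c oU Ux (sT I szI)) Ssym.
rewrite (act_eq curvE (fun J _ => erefl (T0 J))) !actBl -act_comm.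
clearbody G dG' T0 dT' S; abstract_ring.
Qed.

(** Contraction with the inverse metric commutes with nabla since g^{-1} is
parallel. *)
Lemma cov_contract c m (F : tensor) I x : U x -> pderivable_tensor m.+2 F ->
  size I = m ->
  cov c (fun J y => \sum_p \sum_q ginv g p q y * F [:: p, q & J] y) I x =
  \sum_p \sum_q ginv g p q x * cov c F [:: p, q & I] x.
Proof.
move=> Ux dF szI; rewrite /cov.
have dI p q : pderivable (F [:: p, q & I]) x by apply: dF; rewrite //= szI.
have dgI p q : pderivable (fun y => ginv g p q y * F [:: p, q & I] y) x.
  by apply: pderivableM => //; apply: pderivable_ginv.
rewrite (partial_sum c (fun p => pderivable_sum (dgI p))) /=.
under eq_bigr => p _.
  rewrite (partial_sum c (dgI p)) /=.
  under eq_bigr => q _.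
    by rewrite (partialM c (pderivable_ginv p q Ux) (dI p q)) partial_ginv //; over.
  over.
have -> : act (fun e b => Gam e c b x)
     (fun J => \sum_p \sum_q ginv g p q x * F [:: p, q & J] x) I =
  \sum_p \sum_q ginv g p q x * act (fun e b => Gam e c b x)
     (fun J => F [:: p, q & J] x) I.
  transitivity (\sum_p 1 * act (fun e b => Gam e c b x) (fun J =>
      \sum_q ginv g p q x * F [:: p, q & J] x) I).
    by rewrite -act_sumr; apply: act_eq => // J _; apply: eq_bigr => p _; rewrite mul1r.
  by apply: eq_bigr => p _; rewrite mul1r act_sumr.
rewrite /=.
pose P1 := \sum_p \sum_q \sum_d Gam p c d x * ginv g d q x * F [:: p, q & I] x.
pose P2 := \sum_p \sum_q \sum_d Gam q c d x * ginv g p d x * F [:: p, q & I] x.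
have P1E : P1 = \sum_p \sum_q ginv g p q x * \sum_d Gam d c p x * F [:: d, q & I] x.
  rewrite /P1 exchange_big [RHS]exchange_big; apply: eq_bigr => q _ /=.
  under [RHS]eq_bigr do rewrite mulr_sumr.
  rewrite exchange_big; apply: eq_bigr => p _; apply: eq_bigr => d _; abstract_ring.
have P2E : P2 = \sum_p \sum_q ginv g p q x * \sum_d Gam d c q x * F [:: p, d & I] x.
  rewrite /P2; apply: eq_bigr => p _; under [RHS]eq_bigr do rewrite mulr_sumr.
  rewrite exchange_big; apply: eq_bigr => q _; apply: eq_bigr => d _; abstract_ring.
transitivity (\sum_p \sum_q ginv g p q x * partial c (F [:: p, q & I]) x
   - P1 - P2 - \sum_p \sum_q ginv g p q x * act (fun e b => Gam e c b x)
     (fun J => F [:: p, q & J] x) I).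
  congr (_ - _); rewrite /P1 /P2 -!sumrB; apply: eq_bigr => p _.
  rewrite -!sumrB; apply: eq_bigr => q _; rewrite -!mulr_suml; abstract_ring.
rewrite P1E P2E -!sumrB; apply: eq_bigr => p _.
by rewrite -!sumrB; apply: eq_bigr => q _; abstract_ring.
Qed.

(** Since g is parallel, only F is differentiated in g_{c [.} F_{...]}. *)
Lemma cov_wedge_metric c d m (F : tensor) I x : U x -> pderivable_tensor m F ->
  size I = m.+1 ->
  cov d (fun J y => if J is c :: J' then wedge1 (fun a => g c a y) (F ^~ y) J' else 0)
      (c :: I) x =
  wedge1 (fun a => g c a x) (cov d F ^~ x) I.
Proof.
move=> Ux dF szI; rewrite {1}/cov /=.
rewrite partial_wedge1; last 2 first.
- by move=> a; apply: pderivable_g.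
- by move=> J; rewrite szI => -[szJ]; apply: dF.
rewrite act_wedge1 -wedge1_suml.
rewrite [wedge1 _ (cov d F ^~ x) I]wedge1Br.
rewrite (@wedge1_eq _ _ (fun a => partial d (g c a) x) (fun a =>
   \sum_e Gam e d c x * g e a x + \sum_e Gam e d a x * g c e x) _ (F ^~ x)) //.
  by rewrite wedge1Dl; abstract_ring.
by move=> a; rewrite partial_metric.
Qed.

Lemma riemann_up_skew x a b c d : riemann_up g a b c d x = - riemann_up g b a c d x.
Proof.
rewrite /riemann_up opprD -sumrN; congr (_ + _); first by abstract_ring.
by apply: eq_bigr => e _; abstract_ring.
Qed.

(** Absence of torsion: the derivative terms cancel by the symmetry of the
Christoffel symbols, and so do the quadratic terms. *)
Lemma riemann_up_bianchi x a b c d : U x ->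
  riemann_up g a b c d x + riemann_up g b d c a x + riemann_up g d a c b x = 0.
Proof.
move=> Ux; have pG f e p q : partial f (Gam e p q) x = partial f (Gam e q p) x.
  by apply: partial_eq oU Ux _ => y Uy; apply: christoffel_sym.
rewrite /riemann_up (pG a c b d) (pG b c a d) (pG d c a b).
pose S1 := \sum_e (Gam c a e x * Gam e b d x - Gam c b e x * Gam e a d x).
pose S2 := \sum_e (Gam c b e x * Gam e d a x - Gam c d e x * Gam e b a x).
pose S3 := \sum_e (Gam c d e x * Gam e a b x - Gam c a e x * Gam e d b x).
have : S1 + S2 + S3 = 0.
  rewrite /S1 /S2 /S3 -!big_split big1 //= => e _.
  rewrite (christoffel_sym e d a Ux) (christoffel_sym e b a Ux).
  by rewrite (christoffel_sym e d b Ux); abstract_ring.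
rewrite -/S1 -/S2 -/S3 => S0; rewrite -[RHS]S0; abstract_ring.
Qed.

Definition metric_field : tensor :=
  fun J x => if J is [:: a; b] then g a b x else 0.

Lemma cov_metric c a b x : U x -> cov c metric_field [:: a; b] x = 0.
Proof. by move=> Ux; rewrite /cov /= partial_metric // addr0 subrr. Qed.

(** The Ricci identity for the parallel tensor g. *)
Lemma riemann_skew_low x a b c d : U x -> riemann g a b c d x = - riemann g a b d c x.
Proof.
move=> Ux; have sg : smooth_tensor 2 metric_field.
  by move=> [|p [|q []]] // _; apply: g_smooth.
have D2 e p : cov e (cov_tensor metric_field) [:: p; c; d] x = 0.
  rewrite /cov /= (@partial_eq _ _ U _ (fun=> 0) e x oU Ux); last first.
    by move=> y Uy; apply: cov_metric.
  rewrite partial_cst addr0.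
  by rewrite !big1 ?addr0 ?subr0 // => f _; rewrite cov_metric // mulr0.
have := ricci_identity b a Ux sg (erefl : size [:: c; d] = 2%N).
rewrite !D2 subr0 /= addr0 => /esym/eqP; rewrite oppr_eq0 addrC addr_eq0 => /eqP.
rewrite /riemann; under eq_bigr do rewrite mulrC.
move=> ->; congr (- _); apply: eq_bigr => e _.
by rewrite mulrC g_sym.
Qed.

Lemma riemann_skew x a b c d : riemann g a b c d x = - riemann g b a c d x.
Proof.
rewrite /riemann -sumrN; apply: eq_bigr => e _.
by rewrite riemann_up_skew mulrN.
Qed.

Lemma riemann_bianchi x a b c d : U x ->
  riemann g a b c d x + riemann g b d c a x + riemann g d a c b x = 0.
Proof.
move=> Ux; rewrite /riemann -!big_split big1 //= => e _.
by rewrite -!mulrDr riemann_up_bianchi // mulr0.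
Qed.

Lemma riemann_pair x a b c d : U x -> riemann g a b c d x = riemann g c d a b x.
Proof.
move=> Ux.
apply: (@pair_symmetry _ _ (fun p q r s => riemann g p q r s x)) => p q r s.
- exact: riemann_skew.
- exact: riemann_skew_low.
- exact: riemann_bianchi.
Qed.

Lemma riemann_upE x a b c d : U x ->
  riemann_up g a b c d x = \sum_e ginv g c e x * riemann g a b e d x.
Proof.
move=> Ux; rewrite /riemann; under eq_bigr do rewrite mulr_sumr.
rewrite exchange_big /= -[LHS](sum_delta c (fun e => riemann_up g a b e d x)).
apply: eq_bigr => e _; rewrite -(ginv_mul c e Ux) mulr_suml.
by apply: eq_bigr => f _; abstract_ring.
Qed.

Lemma ricciE x b d : U x ->
  ricci g b d x = \sum_p \sum_q ginv g p q x * riemann g p b q d x.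
Proof. by move=> Ux; apply: eq_bigr => p _; rewrite riemann_upE. Qed.

Lemma ricci_sym x b d : U x -> ricci g b d x = ricci g d b x.
Proof.
move=> Ux; rewrite (ricciE b d Ux) (ricciE d b Ux) exchange_big.
apply: eq_bigr => q _; apply: eq_bigr => p _.
by rewrite (ginv_sym p q Ux) (riemann_pair p b q d Ux).
Qed.

End Metric.
End Covariant.

(** * Contractions of a curvature tensor with a form *)

Section Contraction.
Context {R : realFieldType} {V : finType} (G : V -> V -> R).
Context (G_sym : forall p q, G p q = G q p).

Definition contract f := \sum_p \sum_q G p q * f p q.

Lemma contract_eq f f' : (forall p q, f p q = f' p q) -> contract f = contract f'.
Proof. by move=> ff'; apply: eq_bigr => p _; apply: eq_bigr => q _; rewrite ff'. Qed.

Lemma contractD f f' :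
  contract (fun p q => f p q + f' p q) = contract f + contract f'.
Proof.
rewrite -big_split; apply: eq_bigr => p _; rewrite -big_split.
by apply: eq_bigr => q _; rewrite mulrDr.
Qed.

Lemma contractZ c f : contract (fun p q => c * f p q) = c * contract f.
Proof.
rewrite mulr_sumr; apply: eq_bigr => p _; rewrite mulr_sumr.
by apply: eq_bigr => q _; rewrite mulrCA.
Qed.

Lemma contractN f : contract (fun p q => - f p q) = - contract f.
Proof. by rewrite -mulN1r -contractZ; apply: contract_eq => p q; rewrite mulN1r. Qed.

Lemma contractB f f' :
  contract (fun p q => f p q - f' p q) = contract f - contract f'.
Proof. by rewrite contractD contractN. Qed.

Lemma contract0 f : (forall p q, f p q = 0) -> contract f = 0.
Proof. by move=> f0; rewrite /contract big1 // => p _; rewrite big1 // => q _; rewrite f0 mulr0. Qed.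

Lemma contractC f : contract f = contract (fun p q => f q p).
Proof.
rewrite /contract exchange_big; apply: eq_bigr => p _; apply: eq_bigr => q _.
by rewrite G_sym.
Qed.

Lemma contract_skew f : (forall p q, f p q = - f q p) -> contract f = 0.
Proof.
move=> skf; have := contractC f.
rewrite [in RHS](@contract_eq (fun p q => f q p) (fun p q => - f p q)) //.
by rewrite contractN; lra.
Qed.

Lemma contract_exchange (f : V -> V -> V -> V -> R) :
  contract (fun p q => contract (f p q)) =
  contract (fun r s => contract (fun p q => f p q r s)).
Proof.
transitivity (\sum_p \sum_q \sum_r \sum_s G p q * (G r s * f p q r s)).
  apply: eq_bigr => p _; apply: eq_bigr => q _; rewrite mulr_sumr.
  by apply: eq_bigr => r _; rewrite mulr_sumr.
transitivity (\sum_r \sum_s \sum_p \sum_q G p q * (G r s * f p q r s)).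
  under eq_bigr do rewrite exchange_big /=.
  rewrite exchange_big /=; apply: eq_bigr => r _.
  under eq_bigr do rewrite exchange_big /=.
  by rewrite exchange_big.
apply: eq_bigr => r _; apply: eq_bigr => s _; rewrite mulr_sumr.
apply: eq_bigr => p _; rewrite mulr_sumr; apply: eq_bigr => q _.
by rewrite mulrCA.
Qed.

(** A raised index is moved into a contraction, where it can be permuted with
the other contracted pairs. *)
Lemma contract_mulr_sum (h : V -> R) (r : V -> R) :
  \sum_e (\sum_i G e i * r i) * h e = contract (fun e f => r f * h e).
Proof.
apply: eq_bigr => e _; rewrite mulr_suml.
by apply: eq_bigr => p _; rewrite mulrA.
Qed.

Section Curvature.
Context (r : V -> V -> V -> V -> R).
Context (r_skewl : forall a b c d, r a b c d = - r b a c d).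
Context (r_skewr : forall a b c d, r a b c d = - r a b d c).
Context (r_cyc : forall a b c d, r a b c d + r b d c a + r d a c b = 0).
Context (r_pair : forall a b c d, r a b c d = r c d a b).

Definition raised (t : V -> V -> V -> V -> R) a b e d :=
  \sum_i G e i * t a b i d.

Lemma contract_cyc (h : V -> V -> V -> V -> V -> V -> R) :
  contract (fun p q => contract (fun u s => contract (fun e f => h p q u s e f))) =
  contract (fun p q => contract (fun u s => contract (fun e f => h e f p q u s))).
Proof.
rewrite contract_exchange.
transitivity (contract (fun u s => contract (fun e f => contract (fun p q => h p q u s e f)))).
  by apply: contract_eq => u s; rewrite contract_exchange.
by [].
Qed.

(** When the curvature acts on one of the free indices b, the three contracted
indices of r_{q u b f} meet three indices of F, so only the cyclic sum counts, and
it vanishes.  The induction moves the remaining indices to the front, where they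
are spectators. *)
Lemma act_raised_bianchi m (F : seq V -> R) K : alternates m F ->
  (size K).+2 = m ->
  contract (fun q p => contract (fun u s =>
    act (raised r q u) (fun J => F [:: s, p & J]) K)) = 0.
Proof.
elim: K m F => [|b K IH] m F altF sz /=.
  by apply: contract0 => q p; apply: contract0.
rewrite (@contract_eq _ (fun q p =>
    contract (fun u s => contract (fun f e => - r q u b f * F [:: s, p, e & K])) +
    contract (fun u s => act (raised r q u) (fun J => F [:: b, s, p & J]) K))); last first.
  move=> q p; rewrite -contractD; apply: contract_eq => u s.
  rewrite (contract_mulr_sum (fun e => F [:: s, p, e & K])); congr (_ + _).
    by rewrite contractC; apply: contract_eq => f e; rewrite r_skewr.
  apply: act_eq => // J szJ.
  case: m altF sz => [|[|[|m]]] //= altF [sz].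
  rewrite (alternates_swap (alternates_cons altF)) /= ?szJ ?sz //.
  by rewrite (alternates_swap altF) /= ?szJ ?sz // opprK.
rewrite contractD (IH m.-1 (fun J => F (b :: J))); last 2 first.
- by case: m altF sz => // m altF _; apply: alternates_cons.
- by rewrite -sz.
rewrite addr0.
pose h q p u s f e := - r q u b f * F [:: s, p, e & K].
rewrite (_ : contract _ = contract (fun q p => contract (fun u s =>
   contract (fun f e => h q p u s f e)))) //.
set Z := contract _.
have E1 : Z = _ := contract_cyc h.
have E2 := contract_cyc (fun q p u s f e => h f e q p u s).
(* The same sum with its contracted pairs renamed cyclically. *)
suff : Z + Z + Z = 0 by lra.
rewrite [X in _ + X = _](etrans E1 E2) [X in _ + X + _]E1 -!contractD.
apply: contract0 => q p.
rewrite -!contractD; apply: contract0 => u s.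
rewrite -!contractD; apply: contract0 => f e.
have swF x y z : F [:: x, y, z & K] = F [:: y, z, x & K].
  case: m altF sz => [|[|[|m]]] //= altF [sz].
  rewrite (alternates_swap altF) /= ?sz //.
  by rewrite (alternates_swap (alternates_cons altF)) /= ?sz // opprK.
rewrite /h (swF s p e) (swF e s p) (swF s p e).
have := r_cyc q u b f; move: (F _) (r q u b f) (r u f b q) (r f q b u) => x y z t.
by move=> yzt; rewrite -[RHS](mul0r (- x)) -yzt; ring.
Qed.

(** Renaming the contracted pairs transposes both factors; this fixes m and
changes the sign of h. *)
Lemma contract_sym_skew (m h : V -> V -> R) :
  (forall p q, m p q = m q p) -> (forall p q, h p q = - h q p) ->
  contract (fun q p => contract (fun e f => m q f * h e p)) = 0.
Proof.
move=> m_sym h_skew; set X := LHS; suff : X = - X by lra.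
rewrite {1}/X contract_exchange contractC /X -contractN.
apply: contract_eq => q p; rewrite -contractN contractC.
by apply: contract_eq => e f; rewrite m_sym h_skew mulrN.
Qed.

(** This is what makes the codifferential square to zero.  Acting on p or on s,
the curvature is contracted to the Ricci tensor, which is symmetric; the other
indices are covered by the cyclic identity. *)
Lemma contract_act_raised m (F : seq V -> R) K : alternates m F ->
  (size K).+2 = m ->
  contract (fun q p => contract (fun u s =>
    act (raised r q u) F [:: s, p & K])) = 0.
Proof.
move=> altF sz; have skF s p : F [:: s, p & K] = - F [:: p, s & K].
  exact: alternates_swap altF _.
rewrite (@contract_eq _ (fun q p =>
    contract (fun e f => contract (fun u s => r q u f s) * F [:: e, p & K]) +
    contract (fun u s => contract (fun e f => r q u f p * F [:: s, e & K])) +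
    contract (fun u s => act (raised r q u) (fun J => F [:: s, p & J]) K))); last first.
  move=> q p; rewrite -addrA -contractD.
  rewrite (@contract_eq (fun e f => _ * _) (fun e f =>
     contract (fun u s => r q u f s * F [:: e, p & K]))); last first.
    move=> e f; rewrite mulrC -contractZ; apply: contract_eq => u s.
    by rewrite mulrC.
  rewrite contract_exchange -contractD; apply: contract_eq => u s /=.
  by rewrite !contract_mulr_sum.
rewrite !contractD (act_raised_bianchi altF) // addr0.
rewrite contract_sym_skew //; last first.
  move=> q f; rewrite contractC; apply: contract_eq => u s.
  by rewrite r_pair.
rewrite add0r contract_exchange.
pose m' u f := contract (fun q p => r q u f p).
rewrite (@contract_eq _ (fun u s => contract (fun e f =>
    m' u f * - F [:: e, s & K]))); last first.
  move=> u s; rewrite contract_exchange; apply: contract_eq => e f.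
  rewrite mulrC -contractZ; apply: contract_eq => q p.
  by rewrite [in RHS]mulrC -skF.
apply: contract_sym_skew => [u f|e s]; last by rewrite skF.
rewrite /m' contractC; apply: contract_eq => q p.
by rewrite r_pair r_skewl r_skewr opprK.
Qed.

Context (g P : V -> V -> R).
Context (gG : forall a b, \sum_e G a e * g e b = (a == b)%:R).
Context (g_sym : forall a b, g a b = g b a).
Context (P_sym : forall a b, P a b = P b a).

Lemma contract_metric (h : V -> R) c : contract (fun e f => g f c * h e) = h c.
Proof.
rewrite -contract_mulr_sum.
rewrite (bigD1 c) //= gG eqxx mul1r big1 ?addr0 // => e /negbTE ec.
by rewrite gG ec mul0r.
Qed.

Lemma contract_metric' (h : V -> R) c : contract (fun f e => g c f * h e) = h c.
Proof.
rewrite contractC -[RHS]contract_metric; apply: contract_eq => e f.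
by rewrite g_sym.
Qed.

(** The difference between the Riemann tensor and the Weyl tensor. *)
Definition schouten_part a b c d :=
  g c a * P b d - g c b * P a d + (g d b * P a c - g d a * P b c).

(** For one index b of K, the four terms of the Schouten part give: a term skew
in c and a, the trace of a form (zero), the action of P on the first index of F,
and a contraction of P with a form (zero).  So each index of K contributes the same
amount. *)
Lemma raised_schouten_part m (F : seq V -> R) (c a : V) K : alternates m F ->
  (size K).+2 = m ->
  contract (fun q p => act (raised schouten_part c q) (fun J => F [:: p, a & J]) K) +
  contract (fun q p => act (raised schouten_part a q) (fun J => F [:: p, c & J]) K) =
  - (size K)%:R *
    (contract (fun e f => P c f * F [:: e, a & K]) +
     contract (fun e f => P a f * F [:: e, c & K])).
Proof.
elim: K m F => [|b K IH] m F altF sz /=.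
  by rewrite oppr0 mul0r !contract0 ?addr0.
have altFb : alternates m.-1 (fun J => F (b :: J)).
  by case: m altF sz => // m altF _; apply: alternates_cons.
have sw01 x y z : F [:: x, y, z & K] = - F [:: y, x, z & K].
  by apply: alternates_swap altF _.
have sw12 x y z : F [:: x, y, z & K] = - F [:: x, z, y & K].
  by case: m altF sz {altFb} => // m altF [sz]; apply: alternates_swap (alternates_cons altF) _.
have sw02 x y z : F [:: x, y, z & K] = - F [:: z, y, x & K].
  by rewrite sw01 sw12 sw01 opprK.
have E c' a' : contract (fun q p =>
      \sum_d raised schouten_part c' q d b * F [:: p, a', d & K] +
      act (raised schouten_part c' q) (fun J => F [:: p, a', b & J]) K) =
    contract (fun q p => P q b * F [:: p, a', c' & K])
    - contract (fun e f => P c' f * F [:: e, a', b & K])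
    + contract (fun q p =>
        act (raised schouten_part c' q) (fun J => F [:: b, p, a' & J]) K).
  rewrite contractD; congr (_ + _); last first.
    apply: contract_eq => q p; apply: act_eq => // J szJ.
    case: m altF sz {altFb} => // m altF [sz].
    rewrite (alternates_swap (alternates_cons altF)) /= ?szJ //.
    by rewrite (alternates_swap altF) ?opprK //= szJ sz.
  rewrite (@contract_eq _ (fun q p =>
     contract (fun e f => g f c' * (P q b * F [:: p, a', e & K]))
     - P c' b * contract (fun e f => g f q * F [:: p, a', e & K])
     + (g b q * contract (fun e f => P c' f * F [:: p, a', e & K]))
     - g b c' * contract (fun e f => P q f * F [:: p, a', e & K]))); last first.
    move=> q p; rewrite contract_mulr_sum -!contractZ -contractB -contractD.
    rewrite -contractB; apply: contract_eq => e f.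
    by rewrite /schouten_part; ring.
  rewrite contractB contractD contractB !contractZ contract_metric'.
  rewrite (@contract_eq (fun q p => contract (fun e f => g f c' * _)) _
     (fun q p => contract_metric (fun e => P q b * F [:: p, a', e & K]) c')).
  rewrite (@contract_eq (fun q p => contract (fun e f => g f q * _)) _
     (fun q p => contract_metric (fun e => F [:: p, a', e & K]) q)).
  rewrite (@contract_skew (fun q p => F [:: p, a', q & K])) ?mulr0 ?subr0; last first.
    by move=> q p; apply: sw02.
  rewrite (@contract_sym_skew P (fun e p => F [:: p, a', e & K])) // ?mulr0 ?subr0.
  rewrite -(contractN (fun e f => P c' f * F [:: e, a', b & K])).
  congr (_ + _); apply: contract_eq => e f.
  by rewrite sw02 mulrN.
rewrite !E.
rewrite addrACA (IH m.-1 (fun J => F (b :: J))) //; last by rewrite -sz.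
have F3 a' e : F [:: b, e, a' & K] = F [:: e, a', b & K].
  by rewrite sw01 sw12 opprK.
have Eb c' a' : contract (fun e f => P c' f * F [:: b, e, a' & K]) =
               contract (fun e f => P c' f * F [:: e, a', b & K]).
  by apply: contract_eq => e f; rewrite F3.
rewrite !Eb.
have -> : contract (fun q p => P q b * F [:: p, c, a & K]) =
          - contract (fun q p => P q b * F [:: p, a, c & K]).
  by rewrite -contractN; apply: contract_eq => q p; rewrite sw12 mulrN.
by rewrite -[(size K).+1%:R]natr1; ring.
Qed.

(** The Weyl curvature W does not act on the first index a of F, while r acts on
all of them.  On the common indices the two contributions differ by the Schouten
part; on p it leaves (dim - 2) P and a multiple of the skew term F_{c a ...}, on
each of the m - 2 indices of K it leaves -P.  The action of r on a is skew in c and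
a by pair symmetry. *)
Lemma curvature_skew m (W : V -> V -> V -> V -> R) (F : seq V -> R) (c a : V) K :
  alternates m F -> (size K).+2 = m ->
  (forall x y z t, W x y z t = r x y z t - schouten_part x y z t) ->
  let th c a := contract (fun q p => act (raised r c q) F [:: p, a & K])
    + (#|V|%:R - m%:R) * contract (fun e f => P c f * F [:: a, e & K])
    + contract (fun q p => act (raised W c q) (fun J => F (a :: J)) (p :: K)) in
  th c a + th a c = 0.
Proof.
move=> altF sz WE th.
have sk x y : F [:: x, y & K] = - F [:: y, x & K] by apply: alternates_swap altF _.
have E c' a' : th c' a' =
    contract (fun q p => contract (fun e f => r c' q f a' * F [:: p, e & K]))
    + contract (fun q p => contract (fun e f => schouten_part c' q f p * F [:: e, a' & K]))
    - (#|V|%:R - m%:R) * contract (fun e f => P c' f * F [:: e, a' & K])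
    + contract (fun q p => act (raised schouten_part c' q) (fun J => F [:: p, a' & J]) K).
  rewrite /th (@contract_eq (fun e f => P c' f * F [:: a', e & K])
     (fun e f => - (P c' f * F [:: e, a' & K]))); last first.
    by move=> e f; rewrite sk mulrN.
  rewrite contractN mulrN addrAC -contractD [RHS]addrAC -!contractD.
  congr (_ - _); apply: contract_eq => q p /=.
  rewrite -!contract_mulr_sum.
  have actW : act (raised W c' q) (fun J => F [:: a', p & J]) K =
     act (raised schouten_part c' q) (fun J => F [:: p, a' & J]) K
     - act (raised r c' q) (fun J => F [:: p, a' & J]) K.
    rewrite -actBl -[LHS]mulr1 -[X in X = _]opprK -mulrN mulrC -actZr.
    rewrite -[LHS]mulN1r -actZl; apply: act_eq => [d b|J szJ].
      rewrite /raised -sumrB mulr_sumr; apply: eq_bigr => f _.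
      by rewrite WE; ring.
    by rewrite (alternates_swap altF) ?mulN1r ?opprK ?szJ.
  rewrite actW; set A1 := act _ _ _; set A2 := act _ _ _.
  have -> : \sum_d raised W c' q d p * F [:: a', d & K] =
     \sum_d raised schouten_part c' q d p * F [:: d, a' & K]
     - \sum_d raised r c' q d p * F [:: d, a' & K].
    rewrite -sumrB; apply: eq_bigr => d _; rewrite sk mulrN -mulrBl -mulNr.
    congr (_ * _); rewrite /raised -sumrB -sumrN; apply: eq_bigr => f _.
    by rewrite WE; ring.
  by rewrite /raised; ring.
have Q1 c' a' : contract (fun q p => contract (fun e f =>
      schouten_part c' q f p * F [:: e, a' & K])) =
    contract (fun q p => P q p) * F [:: c', a' & K] +
    (#|V|%:R - 2) * contract (fun e f => P c' f * F [:: e, a' & K]).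
  rewrite contract_exchange.
  rewrite (@contract_eq _ (fun e f =>
     contract (fun q p => P q p) * (g f c' * F [:: e, a' & K])
     + (#|V|%:R - 2) * (P c' f * F [:: e, a' & K]))).
    by rewrite contractD !contractZ contract_metric.
  move=> e f; rewrite (@contract_eq _ (fun q p =>
     (g f c' * F [:: e, a' & K]) * P q p
     - (g f q * (P c' p * F [:: e, a' & K]))
     + (P c' f * F [:: e, a' & K] * g p q)
     - (g p c' * (P q f * F [:: e, a' & K])))); last first.
    by move=> q p; rewrite /schouten_part; ring.
  rewrite contractB contractD contractB !contractZ contract_metric' contract_metric.
  rewrite (P_sym c' f) (_ : contract (fun q p => g p q) = #|V|%:R); first by ring.
  rewrite /contract -sum1_card natr_sum; apply: eq_bigr => p _.
  by rewrite gG eqxx.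
have R1 : contract (fun q p => contract (fun e f => r c q f a * F [:: p, e & K])) +
     contract (fun q p => contract (fun e f => r a q f c * F [:: p, e & K])) = 0.
  rewrite -contractD; set X := contract _; suff : X = - X by lra.
  rewrite {1}/X.
  rewrite (@contract_eq _ (fun q p => contract (fun e f =>
     (r c q f a + r a q f c) * F [:: p, e & K]))); last first.
    by move=> q p; rewrite -contractD; apply: contract_eq => e f; rewrite mulrDl.
  rewrite contract_exchange contractC -contractN; apply: contract_eq => q p.
  rewrite contractC -contractD -contractN; apply: contract_eq => e f.
  rewrite sk (r_pair c f q a) (r_pair a f q c) (r_skewl q a) (r_skewr a q).
  by rewrite (r_skewl q c) (r_skewr c q); ring.
rewrite !E !Q1 [F [:: a, c & K]]sk.
have := raised_schouten_part c a altF sz; move: R1.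
set R1 := contract _; set R2 := contract (fun q p => contract _).
set S1 := contract (fun q p => act _ _ _); set S2 := contract (fun q p => act _ _ _).
set P1 := contract (fun e f => P c f * _); set P2 := contract (fun e f => P a f * _).
have -> : m%:R = (size K)%:R + 2 :> R by rewrite -sz -natrD addn2.
move=> R0 S0.
have -> : R2 = - R1 by apply/eqP; rewrite -addr_eq0 addrC R0.
have -> : S2 = - (size K)%:R * (P1 + P2) - S1 by rewrite -S0; ring.
ring.
Qed.

End Curvature.
End Contraction.

(** * Second derivatives of a conformal Killing form *)

Lemma contract_wedge1 (R : realFieldType) (V W : finType) (G : V -> V -> R)
    (h : W -> R) (f : V -> V -> seq W -> R) b :
  contract G (fun p q => wedge1 h (f p q) b) =
  wedge1 h (fun t => contract G (fun p q => f p q t)) b.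
Proof.
rewrite (@wedge1_eq _ _ h h _ (fun t => \sum_p 1 * \sum_q G p q * f p q t)) //.
  by rewrite wedge1_sumr; apply: eq_bigr => p _; rewrite mul1r wedge1_sumr.
by move=> t _; apply: eq_bigr => p _; rewrite mul1r.
Qed.

Lemma alternates_contract (R : realFieldType) (V W : finType) (G : V -> V -> R)
    m (f : V -> V -> seq W -> R) :
  (forall p q, alternates m (f p q)) ->
  alternates m (fun t => contract G (fun p q => f p q t)).
Proof.
move=> altf u a b v sz; rewrite -contractN.
by apply: contract_eq => p q; apply: altf.
Qed.

Lemma killing_operator_eq (R : realType) (n : nat)
    (g : 'I_n -> 'I_n -> 'rV[R]_n -> R) k (sigma : seq 'I_n -> 'rV[R]_n -> R) c I x :
  killing_operator g k sigma c I x = killing_proj g k (cov_tensor g sigma ^~ x) c I x.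
Proof.
congr (killing_proj g k _ c I x).
by apply/funext => -[|d J] //=; rewrite nabla_cov.
Qed.

Section Killing.
Context {R : realType} {n : nat}.
Notation point := 'rV[R]_n.
Notation tensor := (seq 'I_n -> point -> R).
Context (U : set point) (g : 'I_n -> 'I_n -> point -> R).
Context (oU : open U) (g_smooth : forall a b, smooth_on U (g a b)).
Context (g_sym : forall a b x, U x -> g a b x = g b a x).
Context (g_nondeg : forall x, U x -> \det (\matrix_(i, j) g i j x) != 0).
Context (m : nat) (sigma : tensor).
Notation k := m.+2.
Context (sigma_smooth : smooth_tensor U k sigma).
Context (sigma_alt : forall x, U x -> alternates k (sigma ^~ x)).

Notation S := (cov_tensor g sigma).
Notation Gi x := (fun p q => ginv g p q x).
Notation N := (n%:R - k%:R + 1 : R).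

(** The codifferential of sigma, up to sign. *)
Definition codiff : tensor :=
  fun J x => contract (Gi x) (fun p q => S [:: p, q & J] x).

(** N times the trace part of nabla sigma: the form indices are alternated
without normalisation. *)
Definition trace_part : tensor := fun J x =>
  if J is c :: K then wedge1 (fun a => g c a x) (codiff ^~ x) K else 0.

(** The tensor tau of the introduction: it contains the skew part of nabla sigma
and the part that has to vanish. *)
Definition killing_rest : tensor := fun J x => S J x - N^-1 * trace_part J x.

Lemma pderivable_S : pderivable_tensor U k.+1 S.
Proof. exact: (smooth_pderivable_cov_tensor oU g_smooth g_nondeg sigma_smooth). Qed.

Lemma alternates_S c x : U x -> alternates k (fun I => S (c :: I) x).
Proof.
move=> Ux.
exact: (alternates_cov g oU c Ux (smooth_pderivable_tensor sigma_smooth) sigma_alt).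
Qed.

Lemma alternates_codiff x : U x -> alternates m.+1 (codiff ^~ x).
Proof.
move=> Ux; apply: alternates_contract => p q.
exact: alternates_cons (alternates_S p Ux).
Qed.

Lemma alternates_trace_part c x : U x ->
  alternates k (fun I => trace_part (c :: I) x).
Proof. by move=> Ux; apply: alternates_wedge1; apply: alternates_codiff. Qed.

(** The factor k/N of the trace term and the weight-one alternation combine
to 1/N. *)
Lemma killing_operatorE c I x : U x -> size I = k ->
  killing_operator g k sigma c I x =
  killing_rest (c :: I) x - k.+1`!%:R^-1 * alt_sum k.+1 (S ^~ x) (c :: I).
Proof.
move=> Ux szI; rewrite killing_operator_eq /killing_proj !skewsymE.
rewrite [size (c :: I)]/= szI.
rewrite addrAC; congr (_ - _ - _).
rewrite (alt_sum_alternates_tail _ szI) => [|a u b d v sz]; last first.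
  by rewrite [X in _ * X](alternates_codiff Ux) ?mulrN.
have f0 : m.+1`!%:R != 0 :> R by rewrite pnatr_eq0 -lt0n fact_gt0.
have k0 : k%:R != 0 :> R by rewrite pnatr_eq0.
rewrite [k`!]factS natrM -[trace_part _ x]/(front_sum _ I).
move: (front_sum _ I) N^-1 f0 k0 => w t.
by move: (_`!%:R) (k%:R) => f k' f0 k0; field; rewrite f0.
Qed.

Lemma pderivable_codiff : pderivable_tensor U m.+1 codiff.
Proof.
move=> J x szJ Ux; apply: pderivable_sum => p; apply: pderivable_sum => q.
apply: pderivableM; first exact: (pderivable_ginv oU g_smooth g_nondeg Ux).
by apply: (@pderivable_S [:: p, q & J]); rewrite //= szJ.
Qed.

Lemma pderivable_trace_part : pderivable_tensor U k.+1 trace_part.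
Proof.
move=> [|c I] x // [szI] Ux; apply: pderivable_wedge1 => [a|J szJ].
  exact: (pderivable_g g_smooth Ux).
by apply: pderivable_codiff => //; move: szJ; rewrite szI => -[].
Qed.

Lemma pderivable_killing_rest : pderivable_tensor U k.+1 killing_rest.
Proof.
move=> J x szJ Ux; apply: pderivableB; first exact: pderivable_S.
apply: pderivableM; first exact: pderivable_cst.
exact: pderivable_trace_part.
Qed.

Lemma alternates_cov_tail (T : tensor) d c l x : U x ->
  pderivable_tensor U l.+1 T ->
  (forall y e, U y -> alternates l (fun J => T (e :: J) y)) ->
  alternates l (fun J => cov g d T (c :: J) x).
Proof.
move=> Ux dT altT u a b v sz.
have szE y z : size (u ++ y :: z :: v) = l by rewrite size_cat /= -sz !addnS.
rewrite /cov /= (alternates_act _ (altT x c Ux)) //.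
rewrite (partial_eq _ oU Ux (fun y Uy => altT y c Uy u a b v sz)) partialN; last first.
  by apply: dT; rewrite //= szE.
have sumE : \sum_e christoffel g e d c x * T (e :: u ++ [:: a, b & v]) x =
  - \sum_e christoffel g e d c x * T (e :: u ++ [:: b, a & v]) x.
  by rewrite -sumrN; apply: eq_bigr => e _; rewrite (altT x e Ux) // mulrN.
by rewrite sumE -!opprD.
Qed.

Lemma ginv_sym_at x : U x -> forall p q, Gi x p q = Gi x q p.
Proof. by move=> Ux p q; apply: (ginv_sym g_sym). Qed.

Lemma curvature_act x c q (F : seq 'I_n -> R) K : U x ->
  act (fun e b => riemann_up g c q e b x) F K =
  act (raised (Gi x) (fun a b c d => riemann g a b c d x) c q) F K.
Proof. by move=> Ux; apply: act_eq => // e b; apply: (riemann_upE g_nondeg). Qed.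

Lemma ricci_sigma q r I x : U x -> size I = k ->
  cov g q S (r :: I) x - cov g r S (q :: I) x =
  - act (raised (Gi x) (fun a b c d => riemann g a b c d x) q r) (sigma ^~ x) I.
Proof.
move=> Ux szI; rewrite -curvature_act //.
exact: (ricci_identity oU g_smooth g_sym g_nondeg r q Ux sigma_smooth szI).
Qed.

Lemma cov_codiff c J x : U x -> size J = m.+1 ->
  cov g c codiff J x = contract (Gi x) (fun p q => cov g c S [:: p, q & J] x).
Proof.
move=> Ux szJ.
exact: (cov_contract oU g_smooth g_sym g_nondeg c Ux pderivable_S szJ).
Qed.

(** Exchanging the two contracted pairs of derivative and form indices changes
the sign, so that only the commutator of the derivatives remains. *)
Lemma codiff_codiff K x : U x -> size K = m ->
  contract (Gi x) (fun q p => cov g q codiff (p :: K) x) = 0.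
Proof.
move=> Ux szK; have GS := ginv_sym_at Ux.
have skQ q u s p : cov g q S [:: u, s, p & K] x = - cov g q S [:: u, p, s & K] x.
  have altS := @alternates_cov_tail S q u k x Ux pderivable_S
    (fun y e Uy => alternates_S e Uy).
  by apply: (alternates_swap altS); rewrite szK.
set X := LHS.
have XE : X = contract (Gi x) (fun q p => contract (Gi x) (fun u s =>
    cov g q S [:: u, s, p & K] x)).
  by apply: contract_eq => q p; rewrite cov_codiff //= szK.
suff : X + X = 0 by lra.
rewrite {1}XE contract_exchange XE -contractD.
rewrite (@contract_eq _ _ _ _ (fun q p => - contract (Gi x) (fun u s =>
  act (raised (Gi x) (fun a b c d => riemann g a b c d x) q u) (sigma ^~ x)
    [:: s, p & K]))).
  rewrite contractN (contract_act_raised GS _ _ _ _ (sigma_alt Ux)) ?oppr0 ?szK //.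
  - by move=> a b c d; apply: riemann_skew.
  - by move=> a b c d; apply: (riemann_skew_low oU g_smooth g_sym g_nondeg _ _ _ _ Ux).
  - by move=> a b c d; apply: (riemann_bianchi oU g_sym _ _ _ _ Ux).
  - by move=> a b c d; apply: (riemann_pair oU g_smooth g_sym g_nondeg _ _ _ _ Ux).
move=> q p; rewrite -contractD -contractN; apply: contract_eq => u s.
by rewrite addrC [cov g u S _ x]skQ ricci_sigma //= szK.
Qed.

Section ConformalKilling.
Context (kn : (k < n)%N).
Context (ck : forall x, U x -> forall c I, size I = k ->
  killing_operator g k sigma c I x = 0).

Lemma alternates_killing_rest x : U x -> alternates k.+1 (killing_rest ^~ x).
Proof.
move=> Ux; apply: (@alternates_eq _ _ _
    (fun J => k.+1`!%:R^-1 * alt_sum k.+1 (S ^~ x) J)).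
  move=> [|c I] // [szI]; have := ck Ux c szI.
  by rewrite (killing_operatorE _ Ux szI) => /eqP; rewrite subr_eq0 => /eqP.
move=> u a b v sz; rewrite -mulrN; congr (_ * _).
exact: alternates_alt_sum.
Qed.

Notation Riem x := (fun a b c d => riemann g a b c d x).

(** The divergence of nabla sigma in its form index is computed twice: by
commuting derivatives, and from the splitting of nabla sigma.  In the trace part,
nabla delta itself reappears with the factor 1/N, and all its other terms contain the
divergence of delta. *)
Lemma cov_codiff_killing c a K x : U x -> size K = m ->
  (1 - N^-1) * cov g c codiff (a :: K) x =
  contract (Gi x) (fun q p => cov g q killing_rest [:: c, p, a & K] x)
  - contract (Gi x) (fun q p => act (raised (Gi x) (Riem x) c q) (sigma ^~ x)
      [:: p, a & K]).
Proof.
move=> Ux szK; have GS := ginv_sym_at Ux.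
have szpa (p : 'I_n) : size [:: p, a & K] = k by rewrite /= szK.
suff E : cov g c codiff (a :: K) x =
   contract (Gi x) (fun q p => cov g q killing_rest [:: c, p, a & K] x)
   + N^-1 * cov g c codiff (a :: K) x
   - contract (Gi x) (fun q p => act (raised (Gi x) (Riem x) c q) (sigma ^~ x)
      [:: p, a & K]).
  by rewrite mulrBl mul1r {1}E addrAC addrK.
have traceE : cov g c codiff (a :: K) x =
    contract (Gi x) (fun q p => cov g q trace_part [:: c, p, a & K] x).
  rewrite (@contract_eq _ _ _ (fun q p => cov g q trace_part [:: c, p, a & K] x)
    (fun q p => g p c x * cov g q codiff (a :: K) x
       - (g c a x * cov g q codiff (p :: K) x
          - wedge1 (fun b => g c b x) (fun t => cov g q codiff [:: p, a & t] x) K))).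
    rewrite 2!contractB contractZ codiff_codiff // mulr0 contract_wedge1.
    rewrite wedge1_0r => [|t]; last by rewrite szK => szt; apply: codiff_codiff.
    rewrite !subr0 (@contract_metric _ _ (Gi x) (fun a b => g a b x)) //.
    by move=> e f; apply: (ginv_mul g_nondeg).
  move=> q p; rewrite (cov_wedge_metric oU g_smooth g_sym g_nondeg c q Ux
    pderivable_codiff (szpa p)).
  by rewrite !wedge1_cons (g_sym c p Ux).
rewrite {1}cov_codiff /= ?szK // traceE -contractZ -contractD -contractB.
apply: contract_eq => q p.
rewrite -[LHS](subrK (cov g q S [:: c, p, a & K] x)) ricci_sigma // addrC.
congr (_ - _).
have dS : pderivable_tensor U k.+1 (fun J y => N^-1 * trace_part J y).
  move=> J y szJ Uy; apply: pderivableM; first exact: pderivable_cst.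
  exact: pderivable_trace_part.
have szJ : size [:: c, p, a & K] = k.+1 by rewrite /= szK.
rewrite -(covZ g q N^-1 Ux szJ pderivable_trace_part).
rewrite -(covD g q Ux szJ pderivable_killing_rest dS).
by apply: (cov_eq g oU q Ux) => J y _ _; rewrite subrK.
Qed.

(** The expression is N/(n-k) times the difference of two terms that are skew
in c and a: the divergence of tau, and the combination of curvatures treated in
curvature_skew. *)
Lemma x_component_skew c a K x : U x -> size K = m ->
  let E c a := cov g c codiff (a :: K) x
    - N * contract (Gi x) (fun e f => schouten g c f x * sigma [:: a, e & K] x)
    - N / (n%:R - k%:R) * contract (Gi x) (fun q p =>
        act (raised (Gi x) (fun a b c d => weyl g a b c d x) c q)
            (fun J => sigma (a :: J) x) (p :: K)) in
  E c a + E a c = 0.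
Proof.
move=> Ux szK E; have GS := ginv_sym_at Ux.
have nk0 : n%:R - k%:R != 0 :> R by rewrite subr_eq0 eqr_nat gtn_eqF.
have N0 : N != 0 by rewrite -natrB 1?ltnW // natr1 pnatr_eq0.
have DE c' a' : cov g c' codiff (a' :: K) x = N / (n%:R - k%:R) *
   (contract (Gi x) (fun q p => cov g q killing_rest [:: c', p, a' & K] x)
   - contract (Gi x) (fun q p => act (raised (Gi x) (Riem x) c' q) (sigma ^~ x)
      [:: p, a' & K])).
  rewrite -cov_codiff_killing //; move: (cov _ _ _ _ _) nk0 N0 => D.
  by move: (n%:R - k%:R) => d d0 d10; field; rewrite d0 d10.
have restE : contract (Gi x) (fun q p => cov g q killing_rest [:: a, p, c & K] x)
  = - contract (Gi x) (fun q p => cov g q killing_rest [:: c, p, a & K] x).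
  rewrite -contractN; apply: contract_eq => q p.
  have alt := alternates_cov g oU q Ux pderivable_killing_rest alternates_killing_rest.
  rewrite (alternates_swap alt) /= ?szK //.
  rewrite (alternates_swap (alternates_cons alt)) /= ?szK //.
  by rewrite (alternates_swap alt) /= ?szK // opprK.
have gG a' b' : \sum_e Gi x a' e * g e b' x = (a' == b')%:R by apply: (ginv_mul g_nondeg).
have gS a' b' : g a' b' x = g b' a' x by apply: g_sym.
have PS a' b' : schouten g a' b' x = schouten g b' a' x.
  by rewrite /schouten (ricci_sym oU g_smooth g_sym g_nondeg a' b' Ux) (gS a').
have := @curvature_skew _ _ _ GS (Riem x)
  (riemann_skew g x)
  (fun a b c d => riemann_skew_low oU g_smooth g_sym g_nondeg a b c d Ux)
  (fun a b c d => riemann_pair oU g_smooth g_sym g_nondeg a b c d Ux)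
  (fun a b => g a b x) (fun a b => schouten g a b x) gG gS PS k
  (fun a b c d => weyl g a b c d x) (sigma ^~ x) c a K (sigma_alt Ux).
rewrite szK card_ord => /(_ erefl).
have WE y z t w : weyl g y z t w x = Riem x y z t w
   - schouten_part (fun a b => g a b x) (fun a b => schouten g a b x) y z t w.
  by rewrite /weyl /schouten_part -addrA -opprD.
move=> /(_ WE); rewrite /E !DE restE; cbv beta zeta.
repeat match goal with |- context [?t] =>
  lazymatch t with contract _ _ => move: t => ? end end.
move: (n%:R - k%:R) nk0 {N0 DE E} => d d0 H.
rewrite -[RHS](mulr0 (- ((d + 1) / d))) -[in RHS]H; field.
exact: d0.
Qed.
End ConformalKilling.
End Killing.

(** * Components of the tractor extension *)

Section PermutedAltSum.
Context {R : comPzRingType} {V : eqType}.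

Lemma front_sum_eq_perm (G G' : V -> seq V -> R) s :
  (forall a t, perm_eq (a :: t) s -> G a t = G' a t) ->
  front_sum G s = front_sum G' s.
Proof.
elim: s G G' => [|a s IH] G G' GG' //=; rewrite GG' //.
congr (_ - _); apply: IH => b t bt; apply: GG'.
by rewrite (perm_catCA [:: b] [:: a] t) /= perm_cons.
Qed.

(** The alternation over a list sees only rearrangements of that list; in
particular it cannot leave the set of lists containing a given slot. *)
Lemma alt_sum_eq_perm m (F F' : seq V -> R) s :
  (forall t, perm_eq t s -> F t = F' t) -> alt_sum m F s = alt_sum m F' s.
Proof.
elim: m F F' s => [|m IH] F F' s FF' /=; first exact: FF'.
apply: front_sum_eq_perm => a t pat; apply: IH => u put.
by apply: FF'; rewrite -(permPr pat) perm_cons.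
Qed.

Lemma front_sum0 (G : V -> seq V -> R) s :
  (forall a t, G a t = 0) -> front_sum G s = 0.
Proof.
by move=> G0; elim: s G G0 => [|a s IH] G G0 //=; rewrite G0 IH ?subr0.
Qed.

Lemma alt_sum_perm0 m (F : seq V -> R) s :
  (forall t, perm_eq t s -> F t = 0) -> alt_sum m F s = 0.
Proof.
move=> F0; rewrite (@alt_sum_eq_perm m F (fun=> 0)) // => {F0 F}.
elim: m s => [|m IH] s //=; exact: front_sum0.
Qed.

Lemma front_sum_map (W : Type) (h : W -> V) (G : V -> seq V -> R) s :
  front_sum G (map h s) = front_sum (fun a t => G (h a) (map h t)) s.
Proof. by elim: s G => [|a s IH] G //=; rewrite IH. Qed.

Lemma alt_sum_map m (W : Type) (h : W -> V) (F : seq V -> R) s :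
  alt_sum m F (map h s) = alt_sum m (fun t => F (map h t)) s.
Proof.
elim: m F s => [|m IH] F s //=; rewrite front_sum_map.
by congr (front_sum _ s); apply/funext => a; apply/funext => t; rewrite IH.
Qed.
End PermutedAltSum.

Section Extension.
Context {R : realType} {n : nat}.
Notation point := 'rV[R]_n.
Notation tensor := (seq 'I_n -> point -> R).
Context (U : set point) (g : 'I_n -> 'I_n -> point -> R).
Context (oU : open U) (g_smooth : forall a b, smooth_on U (g a b)).
Context (g_sym : forall a b x, U x -> g a b x = g b a x).
Context (g_nondeg : forall x, U x -> \det (\matrix_(i, j) g i j x) != 0).
Context (m : nat) (sigma : tensor).
Notation k := m.+2.
Context (sigma_smooth : smooth_tensor U k sigma).
Context (sigma_alt : forall x, U x -> alternates k (sigma ^~ x)).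

Notation N := (n%:R - k%:R + 1 : R).
Notation T := (tractor_extension g k sigma).
Notation Y := (slotY n).
Notation X := (slotX n).
Notation Z := (@slotZ n).

(** The expression under the skew-symmetrisation in the definition of the
tractor extension. *)
Definition extension_summand (a : 'I_n) (x : point) (S' : seq (slot n)) : R :=
  (n%:R - k%:R + 1) *
    (\sum_(b : (k - 1).-tuple 'I_n) tZs S' b * sigma (a :: b) x)
  - (k%:R - 1) *
    (if S' is B :: S'' then
       tX B * \sum_(b : (k - 2).-tuple 'I_n)
                tZs S'' b * divergence g sigma a b x
     else 0).

Lemma extensionE a S x : size S = m.+1 ->
  T [:: a] S x = m.+1`!%:R^-1 * alt_sum m.+1 (extension_summand a x) S.
Proof. by move=> szS; rewrite /T skewsymE szS. Qed.

Lemma alternates_extension a x : alternates m.+1 (T [:: a] ^~ x).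
Proof.
move=> u B C v sz.
have szE D E : size (u ++ D :: E :: v) = m.+1 by rewrite size_cat /= -sz !addnS.
by rewrite !extensionE // -mulrN (alternates_alt_sum (extension_summand a x) _ _ sz).
Qed.

Lemma summand_nonZ a x B S : size S = m -> ~~ all (@isZ n) S ->
  extension_summand a x (B :: S) = 0.
Proof.
move=> szS nZ; rewrite /extension_summand.
rewrite (sum_tZs_nonZ (fun b => sigma (a :: b) x)) /= ?szS ?negb_and ?nZ ?orbT //.
rewrite (sum_tZs_nonZ (fun b => divergence g sigma a b x)) //.
  by rewrite !mulr0 subr0.
by rewrite szS !subSS subn0.
Qed.

Lemma summand_Y a x S : size S = m -> extension_summand a x (Y :: S) = 0.
Proof.
move=> szS; rewrite /extension_summand.
rewrite (sum_tZs_nonZ (fun b => sigma (a :: b) x)) //= ?szS //.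
by rewrite /tX /= mul0r !mulr0 subr0.
Qed.

Lemma yfree_extension a x : yfree m.+1 (T [:: a] ^~ x).
Proof.
move=> S szS YS; rewrite extensionE // alt_sum_perm0 ?mulr0 // => t pt.
have szt : size t = m.+1 by rewrite (perm_size pt).
have : Y \in t by rewrite (perm_mem pt).
case: t szt {pt} => // B t [szt]; rewrite inE => /orP[/eqP <-|Yt].
  exact: summand_Y.
by apply: summand_nonZ => //; apply/allPn; exists Y.
Qed.

Lemma extension_Z a b x : U x -> size b = m.+1 ->
  T [:: a] (map Z b) x = N * sigma (a :: b) x.
Proof.
move=> Ux szb; rewrite extensionE ?size_map // alt_sum_map.
rewrite (@alt_sum_eq _ _ _ _ (fun b => N * sigma (a :: b) x)) //.
  rewrite alt_sumZ alt_sum_alternates //; last exact: alternates_cons (sigma_alt Ux).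
  have f0 : m.+1`!%:R != 0 :> R by rewrite pnatr_eq0 -lt0n fact_gt0.
  by move: (N) (_`!%:R) f0 => N' f f0; field.
move=> [|c t] // szt; rewrite /extension_summand.
rewrite (sum_tZs_mapZ (fun b => sigma (a :: b) x)) //.
by rewrite /tX /= mul0r mulr0 subr0.
Qed.

Lemma divergenceE a b x : U x -> size b = m ->
  divergence g sigma a b x = - codiff g sigma (a :: b) x.
Proof.
move=> Ux szb; rewrite /divergence /codiff -contractN.
apply: eq_bigr => p _; apply: eq_bigr => q _; rewrite nabla_cov; congr (_ * _).
have := alternates_cov g oU p Ux (smooth_pderivable_tensor sigma_smooth) sigma_alt.
by move=> alt; rewrite (alternates_swap alt) //= szb.
Qed.

(** Of the rearrangements of X Z...Z, only those with X in front contribute.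
They are a fraction 1/(k-1) of all, which cancels the factor k-1. *)
Lemma extension_X a b x : U x -> size b = m ->
  T [:: a] (X :: map Z b) x = codiff g sigma (a :: b) x.
Proof.
move=> Ux szb; rewrite extensionE /= ?size_map ?szb //.
rewrite [X in _ - X](_ : _ = 0) ?subr0.
  rewrite alt_sum_map.
  rewrite (@alt_sum_eq _ _ _ _ (fun b => m.+1%:R * codiff g sigma (a :: b) x)) //.
    rewrite alt_sumZ alt_sum_alternates //; last first.
      exact: alternates_cons (alternates_codiff g oU sigma_smooth sigma_alt Ux).
    have f0 : m`!%:R != 0 :> R by rewrite pnatr_eq0 -lt0n fact_gt0.
    have m0 : m.+1%:R != 0 :> R by rewrite pnatr_eq0.
    rewrite [m.+1`!]factS natrM.
    by move: (m.+1%:R) (_`!%:R) f0 m0 => N' f f0 m0; field; rewrite f0.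
  move=> t szt; rewrite /extension_summand.
  rewrite (sum_tZs_nonZ (fun b => sigma (a :: b) x)) /= ?size_map ?szt //.
  rewrite mulr0 sub0r /tX eqxx mul1r.
  rewrite (sum_tZs_mapZ (fun b => divergence g sigma a b x)); last first.
    by rewrite szt !subSS subn0.
  by rewrite divergenceE // mulrN opprK -[k%:R]natr1 addrK.
apply: etrans (front_sum0 (map Z b) (fun (_ : slot n) _ => erefl 0)).
apply: (@front_sum_eq_perm _ (slot n)) => B t pBt.
apply: alt_sum_perm0 => u pu; apply: summand_nonZ.
  rewrite (perm_size pu) /= ; move/perm_size: pBt => /=.
  by rewrite size_map szb => ->.
by apply/allPn; exists X => //; rewrite (perm_mem pu) inE eqxx.
Qed.

(** * The double action of kappa *)

Lemma sharpE (A : slot n -> slot n -> R) (V : seq (slot n) -> R) S x :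
  sharp g A V S x =
  - act (fun C s => \sum_D tractor_metric g C D x * A D s) V S.
Proof.
rewrite /sharp (actE Y); congr (- _); apply: eq_bigr => j _.
by apply: eq_bigr => C _; rewrite mulr_suml.
Qed.

Lemma tZ_Z d a : tZ (Z d) a = (d == a)%:R :> R.
Proof. by []. Qed.

(** The endomorphism X_[D Z_s]^e with its first index raised. *)
Definition raised_XZ (e : 'I_n) (x : point) (C s : slot n) : R :=
  \sum_D tractor_metric g C D x * (2^-1 * (tX D * tZ s e - tX s * tZ D e)).

Definition raised_curv c (e : 'I_n) (x : point) (C s : slot n) : R :=
  \sum_D tractor_metric g C D x * tractor_curv g c e D s x.

(** By linearity, kappa acts as the sum over e of its decomposable parts:
first the tractor curvature, then X_[. Z_.]^e. *)
Lemma sharp_sharp_kappaE c (V : seq (slot n) -> R) S x :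
  sharp_sharp g (fun E0 E1 F0 F1 => kappa g c E0 E1 F0 F1 x) V S x =
  \sum_e act (raised_XZ e x) (act (raised_curv c e x) V) S.
Proof.
transitivity (\sum_e - \sum_(i < size S) \sum_C \sum_D
    tractor_metric g C D x * (2^-1 * (tX D * tZ (nth Y S i) e - tX (nth Y S i) * tZ D e))
    * - act (raised_curv c e x) V (set_nth Y S i C)); last first.
  apply: eq_bigr => e _; rewrite (actE Y) -sumrN; apply: eq_bigr => i _.
  rewrite -sumrN; apply: eq_bigr => C _; rewrite mulr_suml -sumrN.
  by apply: eq_bigr => D _; rewrite mulrN opprK.
rewrite /sharp_sharp sumrN; congr (- _).
rewrite [RHS]exchange_big; apply: eq_bigr => i _ /=.
rewrite [RHS]exchange_big; apply: eq_bigr => C _ /=.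
rewrite [RHS]exchange_big; apply: eq_bigr => D _ /=.
rewrite sharpE mulrN.
under eq_bigr do rewrite mulrN -mulrA.
rewrite sumrN -mulr_sumr -act_suml; congr (- (_ * _)).
apply: act_eq => // B s; rewrite /kappa /raised_curv.
under eq_bigr do rewrite mulr_sumr.
rewrite exchange_big; apply: eq_bigr => e _ /=; rewrite mulr_sumr.
by apply: eq_bigr => D' _; rewrite mulrCA.
Qed.

Lemma raised_XZ_Y e x C : raised_XZ e x C Y = 0.
Proof.
by rewrite /raised_XZ big1 // => D _; rewrite /tX /tZ /= mulr0 mul0r subrr !mulr0.
Qed.

Lemma raised_XZ_Z e x C b : C != Y -> raised_XZ e x C (Z b) = 0.
Proof.
move=> CY; rewrite /raised_XZ big1 // => -[[[]|d]|[]] _;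
  rewrite /tX /tZ /= ?mul0r ?mulr0 ?subrr ?mulr0 //.
by case: C CY => [[[]|?]|[]] //= _; rewrite mul0r.
Qed.

Lemma raised_XZ_ZX e x a : raised_XZ e x (Z a) X = - (2^-1 * ginv g a e x).
Proof.
rewrite /raised_XZ sum_slot /= mul0r add0r [X in _ + X]mul0r addr0 (bigD1 e) //=.
rewrite big1 => [|d /negbTE de]; rewrite /tX /tZ ?eqxx /= ?mulr0 ?mul1r ?sub0r ?addr0.
  by rewrite mulrN1 mulrN mulrC.
by rewrite -[_ == _]/(d == e) de oppr0 !mulr0.
Qed.

Lemma raised_XZ_XX e x : raised_XZ e x X X = 0.
Proof.
rewrite /raised_XZ sum_slot /= /tX /tZ /= !mul0r ?mulr0 subrr !mulr0.
by rewrite big1 ?addr0 // => d _; rewrite mul0r.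
Qed.

Lemma tractor_curv_Y c e D x : tractor_curv g c e D Y x = 0.
Proof.
rewrite /tractor_curv !big1 ?subr0 // => [a _|a _].
  by rewrite /tX /tZ /= mulr0 mul0r subrr mul0r.
by rewrite big1 // => b _; rewrite /tZ /= mulr0 mul0r.
Qed.

Lemma raised_curv_Y c e x C : raised_curv c e x C Y = 0.
Proof. by rewrite /raised_curv big1 // => D _; rewrite tractor_curv_Y mulr0. Qed.

Lemma tractor_curv_ZZ c e d b x :
  tractor_curv g c e (Z d) (Z b) x = weyl g c e d b x.
Proof.
rewrite /tractor_curv [X in _ - X]big1 ?subr0; last first.
  by move=> a _; rewrite /tX /= !mul0r subrr mul0r.
rewrite (bigD1 d) //= (bigD1 b) //= !big1 => [|a /negbTE ad|a /negbTE ab].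
- by rewrite !tZ_Z !eqxx !mul1r !addr0.
- by rewrite big1 // => a' _; rewrite tZ_Z eq_sym ad !mul0r.
- by rewrite !tZ_Z [b == a]eq_sym ab mulr0 mul0r.
Qed.

Lemma raised_curv_ZZ c e x a b : raised_curv c e x (Z a) (Z b) =
  raised (fun p q => ginv g p q x) (fun a b c d => weyl g a b c d x) c e a b.
Proof.
rewrite /raised_curv sum_slot /= !mul0r add0r addr0.
by apply: eq_bigr => d _; rewrite tractor_curv_ZZ.
Qed.

Lemma raised_curv_XZ c e x b : raised_curv c e x X (Z b) = 0.
Proof.
rewrite /raised_curv sum_slot /= mul0r addr0 [X in _ + X]big1 ?addr0 => [|d _]; last first.
  by rewrite mul0r.
rewrite /tractor_curv !big1 ?subr0 ?mulr0 // => [a _|a _].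
  by rewrite /tX /tZ /= mul0r mul0r subrr mul0r.
by rewrite big1 // => a' _; rewrite /tZ /= mul0r mul0r.
Qed.

Section DoubleAction.
Context (l : nat) (V : seq (slot n) -> R) (c : 'I_n) (x : point).
Context (V_yfree : yfree l V) (V_alt : alternates l V).

Notation kappa_act S :=
  (sharp_sharp g (fun E0 E1 F0 F1 => kappa g c E0 E1 F0 F1 x) V S x).
Let W e := act (raised_curv c e x) V.

Let W_yfree e : yfree l (W e).
Proof. by apply: yfree_act => // C; apply: raised_curv_Y. Qed.

Let W_alt e : alternates l (W e).
Proof. exact: alternates_act. Qed.

Lemma alternates_kappa : alternates l (fun S => kappa_act S).
Proof.
move=> u a b v sz; rewrite !sharp_sharp_kappaE -sumrN.
apply: eq_bigr => e _.
exact: (alternates_act (raised_XZ e x) (W_alt e) a b sz).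
Qed.

Lemma kappa_Y S : (size S).+1 = l -> kappa_act (Y :: S) = 0.
Proof.
move=> szS; rewrite sharp_sharp_kappaE big1 // => e _.
apply: (yfree_act _ (@W_yfree e)) => // C; apply: raised_XZ_Y.
Qed.

(** X_[D Z_s]^e feeds a Z slot only from a Y slot. *)
Lemma act_raised_XZ_Z e l' (F : seq (slot n) -> R) b :
  yfree l' F -> alternates l' F -> size b = l' ->
  act (raised_XZ e x) F (map Z b) = 0.
Proof.
move=> yF altF szb; rewrite (act_mapZ _ yF altF szb) act0l ?wedge1_0l ?addr0 //.
- by move=> a; apply: raised_XZ_Z.
- by move=> d a; apply: raised_XZ_Z.
Qed.

Lemma kappa_Z b : size b = l -> kappa_act (map Z b) = 0.
Proof.
move=> szb; rewrite sharp_sharp_kappaE big1 // => e _.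
exact: act_raised_XZ_Z (@W_yfree e) (@W_alt e) szb.
Qed.

(** The X slot is fed from a Z slot, with the factor 1/2 of the
skew-symmetrisation.  On Z...Z components the tractor curvature is the Weyl
tensor; its Cotton part needs an X or a Y. *)
Lemma kappa_X b : (forall p q, ginv g p q x = ginv g q p x) -> (size b).+1 = l ->
  kappa_act (X :: map Z b) = - (2^-1 * contract (fun p q => ginv g p q x) (fun q p =>
    act (raised (fun p q => ginv g p q x) (fun a b c d => weyl g a b c d x) c q)
        (fun J => V (map Z J)) (p :: b))).
Proof.
move=> GS szb; rewrite sharp_sharp_kappaE mulr_sumr -sumrN.
apply: eq_bigr => e _.
rewrite -[LHS]/(\sum_C raised_XZ e x C X * W e (C :: map Z b) +
  act (raised_XZ e x) (fun K => W e (X :: K)) (map Z b)).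
case: l szb V_yfree V_alt W_yfree W_alt => // l' [szb] Vy Va Wy Wa.
rewrite (@act_raised_XZ_Z e l' (fun K => W e (X :: K))) //; last 2 first.
- exact: yfree_cons (Wy e).
- exact: alternates_cons (Wa e).
rewrite addr0 sum_slot raised_XZ_XX mul0r addr0.
rewrite (Wy e) ?inE ?eqxx //= ?size_map ?szb // mulr0 add0r.
rewrite mulr_sumr -sumrN; apply: eq_bigr => a _.
rewrite raised_XZ_ZX GS mulNr -mulrA; congr (- (_ * (_ * _))).
have szab : size (a :: b) = l'.+1 by rewrite /= szb.
rewrite -[[:: Z a & map Z b]]/(map Z (a :: b)) /W (act_mapZ _ Vy Va szab).
rewrite wedge1_0l ?addr0; last by move=> d; apply: raised_curv_XZ.
exact: (@act_eq _ _ _ _ _ (fun K => V (map Z K)) (a :: b)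
  (fun d f => raised_curv_ZZ c e x d f) (fun _ _ => erefl)).
Qed.

End DoubleAction.

(** * Components of the coupled connection *)

(** The matrix of the tractor connection, so that it becomes a derivation action
on slots: t is the new slot and s the old one. *)
Definition conn c (x : point) (t s : slot n) : R :=
  match s, t with
  | inl (inl _), inl (inr d) => - (c == d)%:R
  | inl (inr b), inl (inl _) => schouten g c b x
  | inl (inr b), inl (inr d) => - christoffel g d c b x
  | inl (inr b), inr _ => g c b x
  | inr _, inl (inr d) => - \sum_a schouten g c a x * ginv g a d x
  | _, _ => 0
  end.

Lemma tractor_connE c s (V : slot n -> R) x :
  tractor_conn g c s V x = \sum_t conn c x t s * V t.
Proof.
rewrite sum_slot; case: s => [[[]|b]|[]] /=.
- rewrite !mul0r add0r addr0; under eq_bigr do rewrite mulNr.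
  by rewrite sumrN sum_delta.
- rewrite addrC addrA; congr (_ + _ + _).
  by rewrite -sumrN; apply: eq_bigr => d _; rewrite mulNr.
- rewrite !mul0r add0r addr0 exchange_big -sumrN; apply: eq_bigr => d _ /=.
  by rewrite mulNr mulr_suml.
Qed.

Lemma nablaE c (F : seq 'I_n -> seq (slot n) -> point -> R) a S x :
  nabla g c F [:: a] S x =
  partial c (F [:: a] S) x - \sum_d christoffel g d c a x * F [:: d] S x
  + act (conn c x) (fun S' => F [:: a] S' x) S.
Proof.
rewrite /nabla big_ord_recl big_ord0 addr0 (actE Y); congr (_ + _).
by apply: eq_bigr => j _; rewrite tractor_connE.
Qed.

Lemma pderivable_divergence a b x : U x -> size b = m ->
  pderivable (divergence g sigma a b) x.
Proof.
move=> Ux szb; apply: pderivable_sum => p; apply: pderivable_sum => q.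
apply: pderivableM; first exact: (pderivable_ginv oU g_smooth g_nondeg Ux).
have szqb : size [:: a, q & b] = k by rewrite /= szb.
have dS : pderivable (cov g p sigma [:: a, q & b]) x :=
  smooth_pderivable_cov oU g_smooth g_nondeg sigma_smooth szqb Ux.
by move: dS; congr (pderivable _ x); apply/funext => y; rewrite nabla_cov.
Qed.

Lemma pderivable_extension a S x : U x -> pderivable (T [:: a] S) x.
Proof.
move=> Ux; rewrite /T /skewsym; apply: pderivableM; first exact: pderivable_cst.
apply: pderivable_sum => p; apply: pderivableM; first exact: pderivable_cst.
apply: pderivableB.
  apply: pderivableM; first exact: pderivable_cst.
  apply: pderivable_sum => b; apply: pderivableM; first exact: pderivable_cst.
  apply: (smooth_pderivable_tensor sigma_smooth _ Ux).
  by rewrite /= size_tuple.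
apply: pderivableM; first exact: pderivable_cst.
case: (permute p) => [|B S']; first exact: pderivable_cst.
apply: pderivableM; first exact: pderivable_cst.
apply: pderivable_sum => b; apply: pderivableM; first exact: pderivable_cst.
by apply: pderivable_divergence => //; rewrite size_tuple !subSS subn0.
Qed.

Notation tilde_nabla c a S x := (nabla_tilde g k c T [:: a] S x).

Lemma alternates_nabla_tilde c a x : U x ->
  alternates m.+1 (fun S => tilde_nabla c a S x).
Proof.
move=> Ux u B C v sz; rewrite /nabla_tilde.
rewrite (alternates_kappa c x (@alternates_extension a x) _ _ sz) mulrN.
apply: etrans (esym (opprD _ _)); congr (_ - _); rewrite !nablaE.
rewrite (alternates_act _ (@alternates_extension a x) _ _ sz) opprD.
congr (_ + _); rewrite opprD; congr (_ + _).
  rewrite -(partialN c (@pderivable_extension a _ x Ux)).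
  by congr (partial c _ x); apply/funext => y; apply: alternates_extension sz.
congr (- _); rewrite -sumrN; apply: eq_bigr => d _.
by rewrite (@alternates_extension d x _ _ _ _ sz) mulrN.
Qed.

Lemma nabla_tilde_Y c a S x : size S = m -> tilde_nabla c a (Y :: S) x = - T [:: a] (Z c :: S) x.
Proof.
move=> szS; rewrite /nabla_tilde nablaE.
rewrite (kappa_Y c x (@yfree_extension a x)) ?szS // mulr0 addr0.
have TY d J y : size J = m -> T [:: d] (Y :: J) y = 0.
  by move=> szJ; apply: yfree_extension; rewrite ?inE ?eqxx //= szJ.
rewrite (_ : partial c _ x = 0) ?sub0r; last first.
  rewrite -[RHS](partial_cst 0 c x); congr (partial c _ x).
  by apply/funext => y; apply: TY.
rewrite [X in - X + _]big1 => [|d _]; last by rewrite TY // mulr0.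
rewrite oppr0 add0r act_cons [X in _ + X]act0r ?addr0; last first.
  by move=> J szJ; rewrite TY // szJ.
rewrite sum_slot /conn mul0r add0r [X in _ + X]mul0r addr0 -[RHS]mulN1r.
rewrite -(sum_delta c (fun d => T [:: a] (Z d :: S) x)) mulr_sumr.
by apply: eq_bigr => d _; rewrite mulN1r mulNr.
Qed.

(** The second term comes from g_{cb} in the tractor connection, which turns the
X Z...Z components into Z...Z components. *)
Lemma nabla_tilde_Z c a b x : U x -> size b = m.+1 ->
  tilde_nabla c a (map Z b) x =
  N * cov g c sigma (a :: b) x +
  wedge1 (fun d => g c d x) (fun J => codiff g sigma (a :: J) x) b.
Proof.
move=> Ux szb; rewrite /nabla_tilde nablaE.
rewrite (kappa_Z c x (@yfree_extension a x) (@alternates_extension a x)) // mulr0 addr0.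
rewrite (act_mapZ _ (@yfree_extension a x) (@alternates_extension a x) szb).
rewrite addrA; congr (_ + _); last first.
  by apply: wedge1_eq => // t; rewrite szb => -[szt]; apply: extension_X.
have ds : pderivable (sigma (a :: b)) x.
  by apply: (smooth_pderivable_tensor sigma_smooth _ Ux); rewrite /= szb.
rewrite (partial_eq c oU Ux (fun y Uy => extension_Z a Uy szb)) (partialZ N c ds).
rewrite /cov act_cons mulrBr mulrDr -addrA; congr (_ + _).
apply: etrans (esym (opprD _ _)); congr (- _ + _).
  by rewrite mulr_sumr; apply: eq_bigr => d _; rewrite extension_Z // mulrCA.
rewrite -actZr -[RHS]mulN1r -actZl; apply: act_eq => [d e|J szJ].
  by rewrite mulN1r.
by rewrite extension_Z // szJ.
Qed.

Lemma nabla_tilde_X c a b x : U x -> size b = m ->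
  tilde_nabla c a (X :: map Z b) x = cov g c (codiff g sigma) (a :: b) x
    - N * contract (fun p q => ginv g p q x)
        (fun e f => schouten g c f x * sigma [:: a, e & b] x)
    - N / (n%:R - k%:R) * contract (fun p q => ginv g p q x) (fun q p =>
        act (raised (fun p q => ginv g p q x) (fun a b c d => weyl g a b c d x) c q)
            (fun J => sigma (a :: J) x) (p :: b)).
Proof.
move=> Ux szb; rewrite /nabla_tilde nablaE.
have szb1 : (size b).+1 = m.+1 by rewrite szb.
have GS p q : ginv g p q x = ginv g q p x by apply: (ginv_sym g_sym).
have yfT := @yfree_extension a x; have altT := @alternates_extension a x.
rewrite (kappa_X c yfT altT GS szb1).
set W := contract _ _; set W' := contract _ (fun q p => act _ (fun J => sigma (a :: J) x) _).
have -> : W = N * W'.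
  rewrite -contractZ; apply: contract_eq => q p.
  apply: etrans (actZr _ N (fun J => sigma (a :: J) x) (p :: b)).
  by apply: act_eq => // J szJ; apply: extension_Z => //; rewrite szJ -szb.
rewrite (_ : 2 / (n%:R - k%:R) * - (2^-1 * (N * W')) = - (N / (n%:R - k%:R) * W')); last first.
  by move: (N) (_ - _)^-1 => N' t; field.
congr (_ - _) => {W W'}.
rewrite (partial_eq c oU Ux (fun y Uy => extension_X a Uy szb)).
rewrite act_cons (act_mapZ _ (yfree_cons X yfT) (alternates_cons altT) szb).
rewrite wedge1_0r ?addr0; last first.
  move=> t szt; apply/eqP; rewrite -eqNr -(alternates_swap altT) //.
  by rewrite size_map szt szb.
rewrite /cov act_cons.
have -> : \sum_t conn c x t X * T [:: a] (t :: map Z b) x =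
   - (N * contract (fun p q => ginv g p q x)
        (fun e f => schouten g c f x * sigma [:: a, e & b] x)).
  rewrite sum_slot /conn mul0r add0r [X in _ + X]mul0r addr0.
  rewrite -[RHS]mulN1r [RHS]mulrA [RHS]mulr_sumr; apply: eq_bigr => d _.
  have szdb : size (d :: b) = m.+1 by rewrite /= szb.
  rewrite -[Z d :: map Z b]/(map Z (d :: b)) (extension_Z a Ux szdb).
  rewrite [LHS]mulNr mulN1r [RHS]mulNr; congr (- _).
  rewrite [LHS]mulr_suml [RHS]mulr_sumr.
  by apply: eq_bigr => f _; rewrite (GS f d); ring.
have -> : act (fun d a0 => conn c x (Z d) (Z a0))
     (fun K => T [:: a] (X :: map Z K) x) b =
   - act (fun e d => christoffel g e c d x) (fun K => codiff g sigma (a :: K) x) b.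
  rewrite -[RHS]mulN1r -actZl; apply: act_eq => [d e|J szJ].
    by rewrite mulN1r.
  by rewrite extension_X // szJ.
have -> : \sum_d christoffel g d c a x * T [:: d] (X :: map Z b) x =
   \sum_d christoffel g d c a x * codiff g sigma (d :: b) x.
  by apply: eq_bigr => d _; rewrite extension_X.
move: (contract _ _) (act _ _ _) (partial _ _ _) (\sum_d _) => C' A' P' S'.
ring.
Qed.

(** * The equivalence *)

Context (kn : (k < n)%N).

Notation rest := (killing_rest g m sigma).
Notation del := (codiff g sigma).
Notation Gi x := (fun p q => ginv g p q x).

Let N0 : N != 0.
Proof. by rewrite -natrB 1?ltnW // natr1 pnatr_eq0. Qed.

Let n0 : n%:R != 0 :> R.
Proof. by rewrite pnatr_eq0 -lt0n (leq_ltn_trans _ kn). Qed.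

(** The components of sigmabar_{a c ...} are those of the forms sigma and delta,
which do not distinguish the form index a from the tractor index c. *)
Lemma extension_Z_skew a c S x : U x -> size S = m ->
  T [:: a] (Z c :: S) x + T [:: c] (Z a :: S) x = 0.
Proof.
move=> Ux.
have altc d e := alternates_cons (a := Z e) (@alternates_extension d x).
apply: (@slot_vanish _ _ m (fun S => T [:: a] (Z c :: S) x + T [:: c] (Z a :: S) x)).
- by move=> u B C v sz; rewrite (altc a c) // (altc c a) // -opprD.
- move=> {}S szS; rewrite !(@yfree_extension _ x) ?addr0 //= ?szS ?inE ?eqxx ?orbT //.
- move=> b szb.
  have swT d e : T [:: d] (Z e :: X :: map Z b) x = - del (d :: e :: b) x.
    rewrite (alternates_swap (@alternates_extension d x)) ?size_map ?szb //.
    by rewrite -[Z e :: _]/(map Z (e :: b)) extension_X.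
  rewrite !swT; have altd := alternates_codiff g oU sigma_smooth sigma_alt Ux.
  by rewrite (alternates_swap altd) ?addNr ?oppr0 //= szb.
- move=> b szb; rewrite -[Z c :: _]/(map Z (c :: b)) -[Z a :: _]/(map Z (a :: b)).
  rewrite !extension_Z ?szb //= ?szb //.
  by rewrite (alternates_swap (sigma_alt Ux)) /= ?szb // mulrN addNr.
Qed.

Lemma sym_tracefree_skew (f : 'I_n -> 'I_n -> R) a b x : U x ->
  (forall p q, f p q + f q p = 0) -> sym_tracefree g f a b x = 0.
Proof.
move=> Ux f0; rewrite /sym_tracefree f0 mulr0 sub0r.
rewrite -[\sum_p _]/(contract (Gi x) f) (contract_skew (ginv_sym_at g_sym Ux)).
  by rewrite mulr0 oppr0.
by move=> p q; apply/eqP; rewrite -addr_eq0 f0.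
Qed.

(** The g delta terms produced by the tractor connection complete nabla sigma to
tau, except for the first one. *)
Lemma nabla_tilde_rest c a b x : U x -> size b = m.+1 ->
  tilde_nabla c a (map Z b) x = N * rest [:: c, a & b] x + g c a x * del b x.
Proof.
move=> Ux szb; rewrite nabla_tilde_Z // /killing_rest [trace_part _ _ _ _]wedge1_cons.
rewrite [cov_tensor _ _ _ _]/=.
by move: (cov _ _ _ _ _) (wedge1 _ _ _) (N) N0 => C' W' N' N0'; field.
Qed.

Lemma contract_metric_dim x : U x -> contract (Gi x) (fun p q => g p q x) = n%:R.
Proof.
move=> Ux; rewrite -[n in RHS]card_ord -sum1_card natr_sum; apply: eq_bigr => p _.
transitivity (\sum_q Gi x p q * g q p x).
  by apply: eq_bigr => q _; rewrite (g_sym p q Ux).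
by rewrite (ginv_mul g_nondeg) // eqxx.
Qed.

(** The trace of the trace part is n - (k - 1) = N times delta. *)
Lemma contract_rest b x : U x -> size b = m.+1 ->
  contract (Gi x) (fun p q => rest [:: p, q & b] x) = 0.
Proof.
move=> Ux szb; have GS := ginv_sym_at g_sym Ux.
rewrite /killing_rest contractB contractZ.
rewrite -[contract _ (fun p q => cov_tensor _ _ _ _)]/(del b x).
rewrite (@contract_eq _ _ _ (fun p q => trace_part g sigma [:: p, q & b] x)
   (fun p q => del b x * g p q x
      - wedge1 (fun d => g p d x) (fun J => del (q :: J) x) b)); last first.
  by move=> p q; rewrite [trace_part _ _ _ _]wedge1_cons mulrC.
rewrite contractB contractZ contract_metric_dim //.
have altd := alternates_codiff g oU sigma_smooth sigma_alt Ux.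
rewrite [contract _ (fun p q => wedge1 _ _ _)](@trace_wedge1 _ _ m.+1
   (fun p d => g p d x) (Gi x) (del ^~ x)) //.
  have -> : m.+1%:R = n%:R - N by rewrite -[k%:R]natr1; ring.
  by move: (N) N0 => N' N0'; field.
move=> q b'; rewrite -(ginv_mul g_nondeg q b' Ux).
by apply: eq_bigr => p _; rewrite GS.
Qed.

Section Forward.
Context (ck : forall x, U x -> forall c I, size I = k ->
  killing_operator g k sigma c I x = 0).

(** All components are skew in a and b except for g_{ab} delta in the slots
Z...Z, which is pure trace. *)
Lemma killing_nabla_tilde a b S x : U x -> size S = m.+1 ->
  sym_tracefree g (fun p q => tilde_nabla p q S x) a b x = 0.
Proof.
move=> Ux; have altN p q := alternates_nabla_tilde p q Ux.
apply: (@slot_vanish _ _ m.+1 (fun S =>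
  sym_tracefree g (fun p q => tilde_nabla p q S x) a b x)).
- move=> u B C v sz; rewrite /sym_tracefree -!/(contract (Gi x) _).
  rewrite (altN a b u) // (altN b a u) //.
  rewrite (@contract_eq _ _ _ (fun p q => tilde_nabla p q (u ++ [:: B, C & v]) x)
    (fun p q => - tilde_nabla p q (u ++ [:: C, B & v]) x)).
    by rewrite contractN; ring.
  by move=> p q; apply: altN.
- move=> {}S [szS]; apply: sym_tracefree_skew => // p q.
  by rewrite !nabla_tilde_Y // -opprD extension_Z_skew // oppr0.
- move=> K [szK]; apply: sym_tracefree_skew => // p q.
  rewrite !nabla_tilde_X //.
  exact: (x_component_skew oU g_smooth g_sym g_nondeg sigma_smooth sigma_alt kn ck
    p q Ux szK).
move=> K szK.
have altr := alternates_killing_rest oU sigma_smooth sigma_alt ck Ux.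
have skr p q : rest [:: p, q & K] x = - rest [:: q, p & K] x.
  by apply: (alternates_swap altr); rewrite szK.
rewrite /sym_tracefree !nabla_tilde_rest // (skr b a) (g_sym b a Ux).
rewrite -[\sum_p _]/(contract (Gi x) _).
rewrite (@contract_eq _ _ _ (fun p q => tilde_nabla p q (map Z K) x)
  (fun p q => N * rest [:: p, q & K] x + del K x * g p q x)); last first.
  by move=> p q; rewrite nabla_tilde_rest // [del K x * _]mulrC.
rewrite contractD !contractZ contract_rest // contract_metric_dim //.
by move: (n%:R) n0 => n' n0'; field.
Qed.
End Forward.

Section Backward.
Context (tk : forall x, U x -> forall a b S, size S = m.+1 ->
  sym_tracefree g (fun p q => tilde_nabla p q S x) a b x = 0).

(** The symmetric trace-free part of the Z...Z components is N tau_{(ca)b}, as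
tau is trace-free. *)
Lemma rest_skew c a b x : U x -> size b = m.+1 ->
  rest [:: c, a & b] x = - rest [:: a, c & b] x.
Proof.
move=> Ux szb; have := tk Ux c a (S := map Z b); rewrite size_map => /(_ szb).
rewrite /sym_tracefree !nabla_tilde_rest // (g_sym a c Ux).
rewrite -[\sum_p _]/(contract (Gi x) _).
rewrite (@contract_eq _ _ _ (fun p q => tilde_nabla p q (map Z b) x)
  (fun p q => N * rest [:: p, q & b] x + del b x * g p q x)); last first.
  by move=> p q; rewrite nabla_tilde_rest // [del b x * _]mulrC.
rewrite contractD !contractZ contract_rest // contract_metric_dim //.
move: (rest _ _) (rest _ _) (g c a x) (del b x) => r1 r2 y z.
move=> H; apply/eqP; rewrite -addr_eq0; apply/eqP/(mulfI N0); rewrite mulr0.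
rewrite -[RHS](mulr0 2) -[in RHS]H.
by move: (N) (n%:R) n0 => N' n' n0'; field.
Qed.

Lemma alternates_rest x : U x -> alternates k.+1 (rest ^~ x).
Proof.
move=> Ux; apply: alternatesS => [c|a b v [szv]]; last exact: rest_skew.
move=> u a b v sz; rewrite /killing_rest.
rewrite (alternates_S g oU sigma_smooth sigma_alt c Ux) //.
rewrite (alternates_trace_part g oU sigma_smooth sigma_alt c Ux) //.
by rewrite mulrN; apply: (esym (opprD _ _)).
Qed.

(** The trace part is an alternation of g_{ca} delta_b, which is symmetric in c
and a. *)
Lemma alt_sum_trace_part J x : U x -> size J = k.+1 ->
  alt_sum k.+1 (trace_part g sigma ^~ x) J = 0.
Proof.
move=> Ux szJ.
pose G L := if L is c :: a :: u then g c a x * del u x else 0.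
have altd := alternates_codiff g oU sigma_smooth sigma_alt Ux.
have G0 : alt_sum k.+1 G J = 0.
  have := alt_sum_swap m.+1 G J.
  rewrite (@alt_sum_eq _ _ _ _ G) // => [|[|c [|a u]] //]; last first.
    by rewrite /= (g_sym c a Ux).
  by move/eqP; rewrite -addr_eq0 -mulr2n mulrn_eq0 => /eqP.
have f0 : m.+1`!%:R != 0 :> R by rewrite pnatr_eq0 -lt0n fact_gt0.
apply: (mulfI f0); rewrite mulr0 -alt_sumZ -[RHS](mulr0 k`!%:R) -[in RHS]G0.
rewrite -(alt_sum_idem G szJ); apply: alt_sum_eq => // -[|c t] // [szt].
rewrite (alt_sum_alternates_tail _ szt) // => a u b d v sz.
by rewrite /= altd // mulrN.
Qed.

(** A totally skew tau is its own skew part, and it has the same skew part as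
nabla sigma. *)
Lemma nabla_tilde_killing x c I : U x -> size I = k ->
  killing_operator g k sigma c I x = 0.
Proof.
move=> Ux szI; rewrite (killing_operatorE g oU sigma_smooth sigma_alt c Ux szI).
have szcI : size (c :: I) = k.+1 by rewrite /= szI.
rewrite (@alt_sum_eq _ _ _ _ (fun J => rest J x + N^-1 * trace_part g sigma J x)) //.
  rewrite alt_sumD alt_sumZ alt_sum_trace_part // mulr0 addr0.
  have f0 : k.+1`!%:R != 0 :> R by rewrite pnatr_eq0 -lt0n fact_gt0.
  by rewrite (alt_sum_alternates (alternates_rest Ux)) // mulKf // subrr.
by move=> J _; rewrite subrK.
Qed.
End Backward.

End Extension.

Lemma chart_image_open (R : realType) (n : nat) (M : topologicalType)
  (phi : chart R n M) : open (cimg phi).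
Proof. by case: phi. Qed.

Local Open Scope ring_scope.
Unset Implicit Arguments.

Theorem proposition4p3 (R : realType) (n : nat) (hn : (3 <= n)%N)
    (M : manifold R n) (c : conformal_structure M)
    (k : nat) (hk : (2 <= k <= n - 1)%N)
    (sigma : weighted_form c k (k%:R + 1))
    (g : metric M) (hg : scales c g) :
  conformal_killing g (sigma g) <-> tractor_killing g (sigma g).
Proof.
move: (sigma g) => s {sigma}; case: k s hk => [|[|m]] // s /andP[_ hk].
have kn : (m.+2 < n)%N.
  by rewrite (leq_ltn_trans hk) // subn1 prednK // (leq_trans _ hn).
have oU (i : mindex M) : open (cimg (mchart i)) by apply: chart_image_open.
have gsm i a b : smooth_on (cimg (mchart i)) (local_metric g i a b).
  by case: g {hg} => -[t st tr] sy dt; apply: (st i [tuple a; b]).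
have gsy i a b x : cimg (mchart i) x -> local_metric g i a b x = local_metric g i b a x.
  by case: g {hg gsm} => t sy dt; apply: sy.
have gdt i x : cimg (mchart i) x -> \det (\matrix_(a, b) local_metric g i a b x) != 0.
  by case: g {hg gsm gsy} => t sy dt; apply: dt.
have ssm i : smooth_tensor (cimg (mchart i)) m.+2 (s i).
  move=> J /eqP szJ; case: s => -[t st tr] sk.
  exact: (st i (Tuple szJ)).
have sal i x : cimg (mchart i) x -> alternates m.+2 (s i ^~ x).
  move=> Ux; apply: skew_alternates => J p szJ.
  by case: s {ssm} => t sk; apply: sk.
split=> [ck i x Ux a b S|tk i x Ux d I].
  apply: (killing_nabla_tilde (oU i) (gsm i) (gsy i) (gdt i) (ssm i) (sal i) kn) => //.
    by move=> y Uy d I /eqP szI; apply: (ck i y Uy d (Tuple szI)).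
  by rewrite size_tuple.
apply: (nabla_tilde_killing (oU i) (gsy i) (gdt i) (ssm i) (sal i) kn) => //.
  by move=> y Uy a b S /eqP szS; apply: (tk i y Uy a b (Tuple szS)).
by rewrite size_tuple.
Qed.
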